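(* For all $r, s > 0$, $$\theta_3(rs)\,\theta_3\!\left(\frac{r}{s}\right) \ge \theta_3(r)^2 \qquad\text{and}\qquad \theta_4(rs)\,\theta_4\!\left(\frac{r}{s}\right) \le \theta_4(r)^2,$$ with equality in either inequality only for $s = 1$.
   Context: For $s>0$, $\theta_3(s) = \sum_{k\in\mathbb{Z}} e^{-\pi k^2 s}$ and $\theta_4(s) = \sum_{k\in\mathbb{Z}} (-1)^k e^{-\pi k^2 s}$. *)

(* Defs.v *)
From Stdlib Require Import Reals Lra Lia ZArith ClassicalEpsilon.
Open Scope R_scope.

Definition theta3_term (s : R) (k : Z) : R := exp (- PI * (IZR k)^2 * s).
Definition theta4_term (s : R) (k : Z) : R :=
  (-1) ^ (Z.abs_nat k) * exp (- PI * (IZR k)^2 * s).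

Definition symsum (f : Z -> R) (N : nat) : R :=
  sum_f_R0 (fun i => f (Z.of_nat i - Z.of_nat N)%Z) (2 * N).

(* the sum over Z, as the limit of the symmetric partial sums
   (the series converge absolutely for s > 0, so this is the sum over Z) *)
Definition zsum (f : Z -> R) : R :=
  epsilon (inhabits 0) (fun l => Un_cv (symsum f) l).

Definition theta3 (s : R) : R := zsum (theta3_term s).
Definition theta4 (s : R) : R := zsum (theta4_term s).

(* Main.v *)
Require Import Defs.
From Stdlib Require Import Reals Lra Lia ZArith ClassicalEpsilon.
From Coquelicot Require Import Coquelicot.
Open Scope R_scope.

(** For [theta3], the claim is that [f x = ln (theta3 (exp x))] is strictly convex.
    When [x >= 0] this is direct: [f'' x > 0] says that [Var X > E X] for the random variable
    [X = PI k^2 exp x] under the weights [exp (- X)], and [X] is either [0] or at least [PI].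
    Jacobi's identity [theta3 (1/t) = sqrt t * theta3 t] gives [f (- x) = f x + x / 2], which
    carries convexity over to [x <= 0].
    Jacobi's identity is obtained by Polya's method, as a limit of the exact formula
    [l * sum_k C(2m, m + k l) / 4^m = sum_{|j| <= n} cos (PI j / l) ^ (2m)], [l = 2n + 1],
    with [m / l^2] tending to [1 / (PI t)].

    For [theta4], the identity [theta3 s * theta4 s = theta4 (2 s) ^ 2] shows that the
    logarithms [L3], [L4] of the quotients to be compared with [1] satisfy
    [L4 r = 2 * L4 (2 r) - L3 r]; since [2^n * L4 (2^n r)] tends to [0] and [L3 > 0],
    first [L4 <= 0] and then [L4 < 0]. *)

(** * Sums over the integers *)

(** The direct variance argument cannot reach all [s > 0]: as [s] tends to [0], [X = PI k^2 s]
    approaches the square of a Gaussian whose mean and variance are both [1/2], so [Var X - E X]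
    tends to [0] and crude termwise bounds fail. The inversion [s -> 1/s] avoids exactly this
    region; its fixed point [s = 1] is the natural place to stop, and there [PI > 3] leaves just
    enough room.

    The scale [m ~ l^2 / (PI t)] is the one at which both sides of the finite formula have limits:
    the normalised binomial weight at [k l] is about [exp (- k^2 l^2 / m)], hence
    [exp (- PI k^2 t)], while [cos (PI j / l) ^ (2m)] is about [exp (- m PI^2 j^2 / l^2)], hence
    [exp (- PI j^2 / t)]. Odd [l] makes [|j| <= n] a full set of residues, symmetric about [0].

    For [theta4] the weights change sign, so there is no random variable to work with, and even
    positivity is not visible in the series. The factor [2^n] in the doubling argument is harmless
    because [theta4 a - 1] decays exponentially in [a]. *)

Definition zfold (f : Z -> R) (n : nat) : R :=
  match n with
  | O => f 0%Z
  | S k => f (Z.of_nat (S k)) + f (- Z.of_nat (S k))%Z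
  end.

(** Pairing [k] with [- k] makes the symmetric partial sums literally the partial sums of a series
    over [nat], so the theory of [Series] applies. *)
Definition ZSeries (f : Z -> R) : R := Series (zfold f).

Lemma symsum_S (f : Z -> R) (N : nat) :
  symsum f (S N) = symsum f N + (f (Z.of_nat (S N)) + f (- Z.of_nat (S N))%Z).
Proof.
  unfold symsum.
  replace (2 * S N)%nat with (S (S (2 * N))) by lia.
  rewrite (decomp_sum _ (S (S (2 * N)))) by lia.
  cbn [Nat.pred].
  rewrite tech5.
  rewrite (sum_eq (fun i => f (Z.of_nat (S i) - Z.of_nat (S N))%Z)
                  (fun i => f (Z.of_nat i - Z.of_nat N)%Z)).
  2: { intros i _; f_equal; lia. }
  replace (Z.of_nat 0 - Z.of_nat (S N))%Z with (- Z.of_nat (S N))%Z by lia.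
  replace (Z.of_nat (S (S (2 * N))) - Z.of_nat (S N))%Z with (Z.of_nat (S N)) by lia.
  ring.
Qed.

Lemma symsum_zfold (f : Z -> R) (N : nat) : symsum f N = sum_n (zfold f) N.
Proof.
  induction N as [|N IH].
  - rewrite sum_O; reflexivity.
  - rewrite symsum_S, sum_Sn, IH; reflexivity.
Qed.

(** Uniqueness of limits pins down the value chosen by [epsilon]. *)
Lemma zsum_eq_of_is_lim (f : Z -> R) (l : R) :
  is_lim_seq (symsum f) l -> zsum f = l.
Proof.
  intros H; apply is_lim_seq_Reals in H.
  apply (UL_sequence (symsum f)); [|exact H].
  unfold zsum; apply epsilon_spec; exists l; exact H.
Qed.

Lemma is_lim_symsum (f : Z -> R) :
  ex_series (zfold f) -> is_lim_seq (symsum f) (ZSeries f).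
Proof.
  intros H; apply Series_correct in H.
  apply (is_lim_seq_ext (sum_n (zfold f))); [|exact H].
  intros n; symmetry; apply symsum_zfold.
Qed.

Lemma ZSeries_eq_of_is_lim (f : Z -> R) (l : R) :
  is_lim_seq (symsum f) l -> ex_series (zfold f) /\ ZSeries f = l.
Proof.
  intros H.
  assert (K : is_series (zfold f) l).
  { apply (is_lim_seq_ext (symsum f) _ _ (symsum_zfold f)) in H; exact H. }
  split; [exists l; exact K | apply is_series_unique, K].
Qed.

Lemma zsum_ZSeries (f : Z -> R) : ex_series (zfold f) -> zsum f = ZSeries f.
Proof. intros H; apply zsum_eq_of_is_lim, is_lim_symsum, H. Qed.

Lemma zfold_ext (f g : Z -> R) : (forall k, f k = g k) -> forall n, zfold f n = zfold g n.
Proof. intros H [|n]; simpl; now rewrite ?H. Qed.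

Lemma zfold_le (f g : Z -> R) : (forall k, f k <= g k) -> forall n, zfold f n <= zfold g n.
Proof. intros H [|n]; [apply H|]; apply Rplus_le_compat; apply H. Qed.

Lemma zfold_abs_le (f M : Z -> R) :
  (forall k, Rabs (f k) <= M k) -> forall n, Rabs (zfold f n) <= zfold M n.
Proof.
  intros H [|n]; [apply H|]; simpl.
  eapply Rle_trans; [apply Rabs_triang|]; apply Rplus_le_compat; apply H.
Qed.

Lemma zfold_nonneg (f : Z -> R) : (forall k, 0 <= f k) -> forall n, 0 <= zfold f n.
Proof. intros H [|n]; [apply H|]; apply Rplus_le_le_0_compat; apply H. Qed.

Lemma zfold_scal (c : R) (f : Z -> R) (n : nat) :
  zfold (fun k => c * f k) n = c * zfold f n.
Proof. destruct n; simpl; ring. Qed.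

Lemma zfold_plus (f g : Z -> R) (n : nat) :
  zfold (fun k => f k + g k) n = zfold f n + zfold g n.
Proof. destruct n; simpl; ring. Qed.

Lemma ZSeries_ext (f g : Z -> R) : (forall k, f k = g k) -> ZSeries f = ZSeries g.
Proof. intros H; apply Series_ext, zfold_ext, H. Qed.

Lemma ZSeries_scal (c : R) (f : Z -> R) : ZSeries (fun k => c * f k) = c * ZSeries f.
Proof.
  unfold ZSeries; rewrite <- Series_scal_l; apply Series_ext; intros n; apply zfold_scal.
Qed.

Lemma ex_zfold_scal (c : R) (f : Z -> R) :
  ex_series (zfold f) -> ex_series (zfold (fun k => c * f k)).
Proof.
  intros H; apply (ex_series_ext (fun n => c * zfold f n)).
  - intros n; symmetry; apply zfold_scal.
  - apply (ex_series_scal (V := R_NormedModule) c _ H).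
Qed.

Lemma ex_zfold_plus (f g : Z -> R) :
  ex_series (zfold f) -> ex_series (zfold g) -> ex_series (zfold (fun k => f k + g k)).
Proof.
  intros Hf Hg; apply (ex_series_ext (fun n => zfold f n + zfold g n)).
  - intros n; symmetry; apply zfold_plus.
  - apply (ex_series_plus (V := R_NormedModule) _ _ Hf Hg).
Qed.

Lemma ZSeries_plus (f g : Z -> R) :
  ex_series (zfold f) -> ex_series (zfold g) ->
  ZSeries (fun k => f k + g k) = ZSeries f + ZSeries g.
Proof.
  intros Hf Hg; unfold ZSeries; rewrite <- Series_plus by assumption.
  apply Series_ext; intros n; apply zfold_plus.
Qed.

Lemma ex_zfold_dominated (f M : Z -> R) :
  ex_series (zfold M) -> (forall k, Rabs (f k) <= M k) -> ex_series (zfold f).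
Proof.
  intros HM H; apply (ex_series_le (V := R_CompleteNormedModule) _ (zfold M)); [|exact HM].
  intros n; apply (zfold_abs_le f M H n).
Qed.

Lemma ZSeries_abs_le (f M : Z -> R) :
  ex_series (zfold M) -> (forall k, Rabs (f k) <= M k) -> Rabs (ZSeries f) <= ZSeries M.
Proof.
  intros HM H; unfold ZSeries.
  assert (E : ex_series (fun n => Rabs (zfold f n))).
  { apply (ex_series_le (V := R_CompleteNormedModule) _ (zfold M)); [|exact HM].
    intros n; change (Rabs (Rabs (zfold f n)) <= zfold M n).
    rewrite Rabs_Rabsolu; apply (zfold_abs_le f M H n). }
  eapply Rle_trans; [apply Series_Rabs, E|].
  apply Series_le; [|exact HM].
  intros n; split; [apply Rabs_pos | apply (zfold_abs_le f M H n)].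
Qed.

(** * Dominated convergence for series *)

Lemma Series_tail_le (u M : nat -> R) (N : nat) :
  ex_series M -> (forall k, Rabs (u k) <= M k) ->
  Rabs (Series u - sum_n u N) <= Series M - sum_n M N.
Proof.
  intros HM H.
  assert (Hu : ex_series u) by (apply (ex_series_le (V := R_CompleteNormedModule) _ M); assumption).
  rewrite (Series_incr_n u (S N)), (Series_incr_n M (S N)) by (assumption || lia).
  rewrite !sum_n_Reals; simpl pred.
  match goal with |- Rabs ?a <= ?b =>
    replace a with (Series (fun k => u (S N + k)%nat)) by ring;
    replace b with (Series (fun k => M (S N + k)%nat)) by ring end.
  assert (HM' : ex_series (fun k => M (S N + k)%nat))
    by (apply (ex_series_incr_n (V := R_NormedModule) M (S N)), HM).
  eapply Rle_trans; [apply Series_Rabs|].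
  - apply (ex_series_le (V := R_CompleteNormedModule) _ (fun k => M (S N + k)%nat)); [|exact HM'].
    intros n; change (Rabs (Rabs (u (S N + n)%nat)) <= M (S N + n)%nat).
    rewrite Rabs_Rabsolu; apply H.
  - apply Series_le; [|exact HM']. intros n; split; [apply Rabs_pos | apply H].
Qed.

Lemma is_lim_sum_n (a : nat -> nat -> R) (b : nat -> R) (N : nat) :
  (forall k, is_lim_seq (fun n => a n k) (b k)) ->
  is_lim_seq (fun n => sum_n (a n) N) (sum_n b N).
Proof.
  intros H; induction N as [|N IH].
  - rewrite sum_O; apply (is_lim_seq_ext (fun n => a n O)); [|apply H].
    intros n; rewrite sum_O; reflexivity.
  - rewrite sum_Sn; apply (is_lim_seq_ext (fun n => sum_n (a n) N + a n (S N))).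
    + intros n; rewrite sum_Sn; reflexivity.
    + apply is_lim_seq_plus'; [exact IH | apply H].
Qed.

(** Tannery's theorem: cut at an [N] where the tail of [M] is below [eps / 3], which bounds the
    tails of all [a n] and of [b] at once, and use termwise convergence on the finite head. The
    bound is asked for only eventually in [n] because the Gaussian bounds used for Jacobi's identity
    start to hold only once [m / l^2] is close to its limit. *)
Lemma Series_dominated (a : nat -> nat -> R) (b M : nat -> R) :
  ex_series M ->
  eventually (fun n => forall k, Rabs (a n k) <= M k) ->
  (forall k, is_lim_seq (fun n => a n k) (b k)) ->
  is_lim_seq (fun n => Series (a n)) (Series b).
Proof.
  intros HM [n0 Hdom] Hlim.
  assert (Hb : forall k, Rabs (b k) <= M k).
  { intros k.
    apply (is_lim_seq_le_loc (fun n => Rabs (a n k)) (fun _ => M k) (Rabs (b k)) (M k)).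
    - exists n0; intros n Hn; apply Hdom, Hn.
    - apply (is_lim_seq_abs _ (b k)), Hlim.
    - apply is_lim_seq_const. }
  apply is_lim_seq_spec; intros eps.
  destruct eps as [eps He]; simpl.
  pose proof (Series_correct M HM) as HS.
  assert (HS' : is_lim_seq (sum_n M) (Series M)) by exact HS.
  apply is_lim_seq_spec in HS'.
  assert (He3 : 0 < eps / 3) by lra.
  destruct (HS' (mkposreal _ He3)) as [N HN]; simpl in HN.
  specialize (HN N (le_n N)).
  pose proof (is_lim_sum_n a b N Hlim) as HF.
  apply is_lim_seq_spec in HF.
  destruct (HF (mkposreal _ He3)) as [n1 Hn1]; simpl in Hn1.
  exists (max n0 n1); intros n Hn.
  specialize (Hn1 n ltac:(lia)).
  pose proof (Series_tail_le (a n) M N HM (Hdom n ltac:(lia))) as T1.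
  pose proof (Series_tail_le b M N HM Hb) as T2.
  assert (T3 : Series M - sum_n M N < eps / 3).
  { apply Rabs_def2 in HN; lra. }
  apply Rabs_def1; apply Rabs_def2 in Hn1; apply Rabs_le_between in T1;
    apply Rabs_le_between in T2; lra.
Qed.

Lemma ZSeries_dominated (a : nat -> Z -> R) (b M : Z -> R) :
  ex_series (zfold M) ->
  eventually (fun n => forall k, Rabs (a n k) <= M k) ->
  (forall k, is_lim_seq (fun n => a n k) (b k)) ->
  is_lim_seq (fun n => ZSeries (a n)) (ZSeries b).
Proof.
  intros HM [n0 Hdom] Hlim.
  apply (Series_dominated (fun n => zfold (a n)) (zfold b) (zfold M) HM).
  - exists n0; intros n Hn; apply zfold_abs_le, Hdom, Hn.
  - intros [|k]; [apply Hlim|]; apply is_lim_seq_plus'; apply Hlim.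
Qed.

Lemma exp_le_compat (x y : R) : x <= y -> exp x <= exp y.
Proof. intros H; apply Rnot_lt_le; intros K; apply exp_lt_inv in K; lra. Qed.

(** The common majorant of the development. Unlike a Gaussian, it changes under a shift of [k] by at
    most a constant factor. *)
Definition zexp (c : R) (k : Z) : R := exp (- c * Rabs (IZR k)).

Lemma zexp_pos (c : R) (k : Z) : 0 < zexp c k.
Proof. apply exp_pos. Qed.

Lemma exp_nat_mul (x : R) (n : nat) : exp (INR n * x) = exp x ^ n.
Proof.
  induction n as [|n IH].
  - simpl; rewrite Rmult_0_l, exp_0; reflexivity.
  - rewrite S_INR, Rmult_plus_distr_r, exp_plus, IH, Rmult_1_l; simpl; ring.
Qed.

Lemma ex_zfold_zexp (c : R) : 0 < c -> ex_series (zfold (zexp c)).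
Proof.
  intros Hc.
  assert (Hq : Rabs (exp (- c)) < 1).
  { rewrite Rabs_pos_eq by (left; apply exp_pos).
    rewrite <- exp_0; apply exp_increasing; lra. }
  apply (ex_series_le (V := R_CompleteNormedModule) _ (fun n => 2 * exp (- c) ^ n)).
  - intros n; change (Rabs (zfold (zexp c) n) <= 2 * exp (- c) ^ n).
    rewrite Rabs_pos_eq by (apply zfold_nonneg; intros; left; apply zexp_pos).
    destruct n as [|n].
    + unfold zfold, zexp; rewrite Rabs_R0, Rmult_0_r, exp_0; simpl; lra.
    + unfold zfold, zexp; rewrite opp_IZR, Rabs_Ropp, <- INR_IZR_INZ.
      rewrite Rabs_pos_eq by apply pos_INR.
      rewrite (Rmult_comm (- c)), exp_nat_mul; lra.
  - apply (ex_series_scal (V := R_NormedModule) 2), ex_series_geom, Hq.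
Qed.

Lemma zexp_0_inf (c : R) : 0 < c -> is_lim_seq (fun n => zexp c (Z.of_nat n)) 0.
Proof.
  intros Hc.
  apply (is_lim_seq_ext (fun n => exp (- c) ^ n)).
  - intros n; unfold zexp; rewrite <- INR_IZR_INZ, Rabs_pos_eq by apply pos_INR.
    rewrite (Rmult_comm (- c)), exp_nat_mul; reflexivity.
  - apply is_lim_seq_geom.
    rewrite Rabs_pos_eq by (left; apply exp_pos).
    rewrite <- exp_0; apply exp_increasing; lra.
Qed.

(** * Translation invariance and exchange of summations *)

Lemma symsum_shift (f : Z -> R) (N : nat) :
  symsum (fun k => f (k + 1)%Z) N = symsum f N + f (Z.of_nat N + 1)%Z - f (- Z.of_nat N)%Z.
Proof.
  induction N as [|N IH].
  - unfold symsum; simpl; ring.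
  - rewrite !symsum_S, IH.
    replace (Z.of_nat N + 1)%Z with (Z.of_nat (S N)) by lia.
    replace (- Z.of_nat (S N) + 1)%Z with (- Z.of_nat N)%Z by lia.
    ring.
Qed.

Lemma ZSeries_opp (f : Z -> R) : ZSeries (fun k => f (- k)%Z) = ZSeries f.
Proof.
  apply Series_ext; intros [|n]; [reflexivity|].
  unfold zfold; rewrite Z.opp_involutive; ring.
Qed.

Lemma is_lim_zfold_0 (f : Z -> R) (c C : R) :
  0 < c -> (forall k, Rabs (f k) <= C * zexp c k) ->
  is_lim_seq (fun n => f (Z.of_nat n)) 0 /\ is_lim_seq (fun n => f (- Z.of_nat n)%Z) 0.
Proof.
  intros Hc Hf.
  assert (L : is_lim_seq (fun n => C * zexp c (Z.of_nat n)) 0).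
  { replace 0 with (C * 0) by ring.
    apply (is_lim_seq_scal_l _ C 0), zexp_0_inf, Hc. }
  split; apply is_lim_seq_abs_0;
    apply (is_lim_seq_le_le (fun _ => 0) _ (fun n => C * zexp c (Z.of_nat n)));
    try exact L; try apply is_lim_seq_const; intros n; split; try apply Rabs_pos.
  - apply Hf.
  - replace (zexp c (Z.of_nat n)) with (zexp c (- Z.of_nat n)%Z); [apply Hf|].
    unfold zexp; rewrite opp_IZR, Rabs_Ropp; reflexivity.
Qed.

Lemma ex_zfold_of_zexp (f : Z -> R) (c C : R) :
  0 < c -> (forall k, Rabs (f k) <= C * zexp c k) -> ex_series (zfold f).
Proof.
  intros Hc Hf; apply (ex_zfold_dominated f (fun k => C * zexp c k)); [|exact Hf].
  apply ex_zfold_scal, ex_zfold_zexp, Hc.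
Qed.

(** Symmetric summation is not translation invariant by itself: the shifted window gains the term at
    [N + 1] and loses the one at [- N], and decay is what makes both corrections vanish. *)
Lemma ZSeries_shift1 (f : Z -> R) (c C : R) :
  0 < c -> (forall k, Rabs (f k) <= C * zexp c k) ->
  ZSeries (fun k => f (k + 1)%Z) = ZSeries f.
Proof.
  intros Hc Hf; apply ZSeries_eq_of_is_lim.
  apply (is_lim_seq_ext (fun N => symsum f N + f (Z.of_nat (S N)) - f (- Z.of_nat N)%Z)).
  { intros N; rewrite symsum_shift; do 3 f_equal; lia. }
  replace (ZSeries f) with (ZSeries f + 0 - 0) by ring.
  destruct (is_lim_zfold_0 f c C Hc Hf) as [L1 L2].
  apply is_lim_seq_minus'; [apply is_lim_seq_plus'|exact L2].
  - apply is_lim_symsum, (ex_zfold_of_zexp f c C Hc Hf).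
  - apply (is_lim_seq_incr_1 (fun n => f (Z.of_nat n))), L1.
Qed.

Lemma zexp_shift (c : R) (k d : Z) : 0 <= c -> zexp c (k + d) <= exp (c * Rabs (IZR d)) * zexp c k.
Proof.
  intros Hc; unfold zexp; rewrite <- exp_plus.
  assert (H : Rabs (IZR k) <= Rabs (IZR (k + d)) + Rabs (IZR d)).
  { replace (IZR k) with (IZR (k + d) + - IZR d) by (rewrite plus_IZR; ring).
    eapply Rle_trans; [apply Rabs_triang|]; rewrite Rabs_Ropp; lra. }
  apply exp_le_compat; nra.
Qed.

Lemma ZSeries_shift (f : Z -> R) (c C : R) (d : Z) :
  0 < c -> 0 <= C -> (forall k, Rabs (f k) <= C * zexp c k) ->
  ZSeries (fun k => f (k + d)%Z) = ZSeries f.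
Proof.
  intros Hc HC Hf.
  assert (Hn : forall n : nat, ZSeries (fun k => f (k + Z.of_nat n)%Z) = ZSeries f
               /\ ZSeries (fun k => f (k - Z.of_nat n)%Z) = ZSeries f).
  { assert (B : forall e k, Rabs (f (k + e)%Z) <= C * exp (c * Rabs (IZR e)) * zexp c k).
    { intros e k; eapply Rle_trans; [apply Hf|].
      rewrite Rmult_assoc; apply Rmult_le_compat_l; [exact HC | apply zexp_shift; lra]. }
    intros n; induction n as [|n [I1 I2]].
    - split; apply ZSeries_ext; intros k; f_equal; lia.
    - split.
      + rewrite <- I1.
        rewrite <- (ZSeries_shift1 (fun k => f (k + Z.of_nat n)%Z) c _ Hc (B (Z.of_nat n))).
        apply ZSeries_ext; intros k; f_equal; lia.
      + rewrite <- I2.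
        rewrite <- (ZSeries_shift1 (fun k => f (k - Z.of_nat (S n))%Z) c _ Hc (B (- Z.of_nat (S n))%Z)).
        apply ZSeries_ext; intros k; f_equal; lia. }
  destruct (Z_le_dec 0 d) as [H|H].
  - replace d with (Z.of_nat (Z.to_nat d)) by lia; apply Hn.
  - replace d with (- Z.of_nat (Z.to_nat (- d)))%Z by lia; apply Hn.
Qed.

Lemma symsum_ext (f g : Z -> R) (N : nat) :
  (forall k, (Z.abs k <= Z.of_nat N)%Z -> f k = g k) -> symsum f N = symsum g N.
Proof.
  intros H; unfold symsum; apply sum_eq; intros i Hi; apply H; lia.
Qed.

Lemma symsum_plus (f g : Z -> R) (N : nat) :
  symsum (fun k => f k + g k) N = symsum f N + symsum g N.
Proof. unfold symsum; apply plus_sum. Qed.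

Lemma symsum_scal (c : R) (f : Z -> R) (N : nat) :
  symsum (fun k => c * f k) N = c * symsum f N.
Proof. unfold symsum; rewrite scal_sum; apply sum_eq; intros; ring. Qed.

Lemma symsum_le (f g : Z -> R) (N : nat) :
  (forall k, f k <= g k) -> symsum f N <= symsum g N.
Proof. intros H; unfold symsum; apply sum_Rle; intros; apply H. Qed.

Lemma symsum_abs (f : Z -> R) (N : nat) :
  Rabs (symsum f N) <= symsum (fun k => Rabs (f k)) N.
Proof. unfold symsum; apply Rsum_abs. Qed.

Lemma symsum_le_ZSeries (f : Z -> R) (N : nat) :
  ex_series (zfold f) -> (forall k, 0 <= f k) -> symsum f N <= ZSeries f.
Proof.
  intros E H; apply (is_lim_seq_incr_compare (symsum f)).
  - apply is_lim_symsum, E.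
  - intros n; rewrite symsum_S.
    pose proof (H (Z.of_nat (S n))); pose proof (H (- Z.of_nat (S n))%Z); lra.
Qed.

Lemma symsum_ZSeries (G : Z -> Z -> R) (c C : R) (N : nat) :
  0 < c -> 0 <= C -> (forall k d, Rabs (G k d) <= C * zexp c k * zexp c d) ->
  symsum (fun k => ZSeries (G k)) N = ZSeries (fun d => symsum (fun k => G k d) N).
Proof.
  intros Hc HC HG.
  assert (E : forall k, ex_series (zfold (G k))) by (intros k; apply (ex_zfold_of_zexp _ c _ Hc (HG k))).
  (* The induction carries summability along, since additivity of [ZSeries] requires it at each
     step. *)
  cut (ex_series (zfold (fun d => symsum (fun k => G k d) N)) /\
       symsum (fun k => ZSeries (G k)) N = ZSeries (fun d => symsum (fun k => G k d) N)).
  { intros H; apply H. }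
  induction N as [|N [I1 I2]].
  - split; [|reflexivity]. apply (E 0%Z).
  - assert (X : forall n, zfold (fun d => symsum (fun k => G k d) N +
                 (G (Z.of_nat (S N)) d + G (- Z.of_nat (S N))%Z d)) n
                 = zfold (fun d => symsum (fun k => G k d) (S N)) n).
    { apply zfold_ext; intros d; rewrite symsum_S; reflexivity. }
    assert (Y := ex_zfold_plus _ _ (E (Z.of_nat (S N))) (E (- Z.of_nat (S N))%Z)).
    split.
    + apply (ex_series_ext _ _ X), ex_zfold_plus; assumption.
    + rewrite symsum_S, I2, <- ZSeries_plus by apply E.
      rewrite <- ZSeries_plus by assumption.
      apply Series_ext, X.
Qed.

(** Finite sums over [k] commute with the sum over [d]; dominated convergence then passes to the
    limit, since every partial sum over [k] is at most [C * ZSeries (zexp c) * zexp c d]. *)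
Lemma ZSeries_Fubini (G : Z -> Z -> R) (c C : R) :
  0 < c -> 0 <= C -> (forall k d, Rabs (G k d) <= C * zexp c k * zexp c d) ->
  ZSeries (fun k => ZSeries (G k)) = ZSeries (fun d => ZSeries (fun k => G k d)).
Proof.
  intros Hc HC HG; apply ZSeries_eq_of_is_lim.
  apply (is_lim_seq_ext (fun N => ZSeries (fun d => symsum (fun k => G k d) N))).
  { intros N; symmetry; apply (symsum_ZSeries G c C N Hc HC HG). }
  assert (HG' : forall d k, Rabs (G k d) <= C * zexp c d * zexp c k).
  { intros d k; eapply Rle_trans; [apply HG|]; right; ring. }
  apply (ZSeries_dominated (fun N d => symsum (fun k => G k d) N) _
           (fun d => C * ZSeries (zexp c) * zexp c d)).
  - apply ex_zfold_scal, ex_zfold_zexp, Hc.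
  - exists O; intros N _ d.
    eapply Rle_trans; [apply symsum_abs|].
    eapply Rle_trans; [apply symsum_le; intros k; apply HG'|].
    rewrite symsum_scal.
    replace (C * ZSeries (zexp c) * zexp c d) with (C * zexp c d * ZSeries (zexp c)) by ring.
    apply Rmult_le_compat_l.
    2: { apply symsum_le_ZSeries; [apply ex_zfold_zexp, Hc | intros; left; apply zexp_pos]. }
    apply Rmult_le_pos; [exact HC | left; apply zexp_pos].
  - intros d; apply is_lim_symsum, (ex_zfold_of_zexp _ c _ Hc (HG' d)).
Qed.

(** * Binomial weights and the finite Poisson formula *)

(* [walk m i] is the binomial weight C(2m, m+i) / 4^m. *)
Fixpoint walk (m : nat) (i : Z) : R :=
  match m with
  | O => if Z.eq_dec i 0 then 1 else 0
  | S m' => (walk m' (i - 1) + 2 * walk m' i + walk m' (i + 1)) / 4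
  end.

Lemma walk_S (m : nat) (i : Z) :
  walk (S m) i = (walk m (i - 1) + 2 * walk m i + walk m (i + 1)) / 4.
Proof. reflexivity. Qed.

Lemma walk_nonneg (m : nat) : forall i, 0 <= walk m i.
Proof.
  induction m as [|m IH]; intros i; [simpl; destruct (Z.eq_dec i 0); lra|].
  rewrite walk_S; pose proof (IH (i - 1)%Z); pose proof (IH i); pose proof (IH (i + 1)%Z); lra.
Qed.

Lemma walk_opp (m : nat) : forall i, walk m (- i) = walk m i.
Proof.
  induction m as [|m IH]; intros i.
  - simpl; destruct (Z.eq_dec (- i) 0), (Z.eq_dec i 0); (reflexivity || lia).
  - rewrite !walk_S.
    replace (- i - 1)%Z with (- (i + 1))%Z by lia.
    replace (- i + 1)%Z with (- (i - 1))%Z by lia.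
    rewrite !IH; field.
Qed.

(** The quotient of consecutive binomial coefficients. Multiplied out, it holds for every integer
    [i], including those outside the support and those where [m + i + 1] vanishes. *)
Lemma walk_ratio (m : nat) :
  forall i, walk m (i + 1) * (INR m + IZR i + 1) = walk m i * (INR m - IZR i).
Proof.
  induction m as [|m IH]; intros i.
  - simpl; destruct (Z.eq_dec (i + 1) 0) as [H|H], (Z.eq_dec i 0) as [H'|H']; try lia.
    + replace i with (-1)%Z by lia; lra.
    + subst; lra.
    + lra.
  - rewrite S_INR, !walk_S.
    pose proof (IH (i - 1)%Z) as E1; pose proof (IH i) as E2; pose proof (IH (i + 1)%Z) as E3.
    replace (i + 1 - 1)%Z with i by lia.
    replace (i - 1 + 1)%Z with i in E1 by lia.
    rewrite minus_IZR in E1; rewrite plus_IZR in E3.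
    nra.
Qed.

Lemma walk_0_S (m : nat) : walk (S m) 0 = walk m 0 * ((2 * INR m + 1) / (2 * INR m + 2)).
Proof.
  pose proof (walk_ratio m 0) as H; simpl (0 + 1)%Z in H.
  rewrite walk_S; change (0 - 1)%Z with (- (1))%Z; rewrite walk_opp; simpl (0 + 1)%Z.
  pose proof (pos_INR m).
  assert (E : walk m 1 = walk m 0 * INR m / (INR m + 1)).
  { apply (Rmult_eq_reg_r (INR m + 1)); [|lra].
    field_simplify; [|lra]. lra. }
  rewrite E; field; lra.
Qed.

Lemma walk_0_pos (m : nat) : 0 < walk m 0.
Proof.
  induction m as [|m IH]; [simpl; lra|].
  rewrite walk_0_S; pose proof (pos_INR m).
  apply Rmult_lt_0_compat; [exact IH|]; apply Rdiv_lt_0_compat; lra.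
Qed.

(** The quotient at [i] is [1 - (2i + 1) / (m + i + 1)], at most [exp (- (2i + 1) / (m + J))] as
    long as [i + 1 <= J]. Fixing [J] gives all exponents one denominator, and the odd numbers
    [2i + 1] add up to a square. The application takes [J = i]. *)
Lemma walk_le (m J : nat) (i : nat) : (i <= J)%nat -> (0 < m + J)%nat ->
  walk m (Z.of_nat i) <= walk m 0 * exp (- (INR i)^2 / (INR m + INR J)).
Proof.
  intros HiJ HmJ; apply lt_INR in HmJ; rewrite plus_INR in HmJ; simpl (INR 0) in HmJ.
  induction i as [|i IH].
  - right. simpl (INR 0). replace (- 0 ^ 2 / (INR m + INR J)) with 0 by (field; lra).
    rewrite exp_0, Rmult_1_r; reflexivity.
  - specialize (IH ltac:(lia)).
    pose proof (walk_ratio m (Z.of_nat i)) as E.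
    replace (Z.of_nat (S i)) with (Z.of_nat i + 1)%Z by lia.
    rewrite <- INR_IZR_INZ in E.
    apply le_INR in HiJ; rewrite S_INR in HiJ.
    pose proof (pos_INR i) as Pi; pose proof (pos_INR m) as Pm.
    set (e := exp (- (2 * INR i + 1) / (INR m + INR J))).
    assert (Ee : exp (- INR (S i) ^ 2 / (INR m + INR J)) =
                 exp (- INR i ^ 2 / (INR m + INR J)) * e).
    { unfold e; rewrite <- exp_plus; f_equal; rewrite S_INR; field; lra. }
    rewrite Ee.
    assert (He : INR m - INR i <= (INR m + INR i + 1) * e).
    { assert (H1 : 1 + - (2 * INR i + 1) / (INR m + INR i + 1) <= e).
      { eapply Rle_trans; [apply exp_ineq1_le|]; apply exp_le_compat.
        unfold Rdiv; rewrite !Ropp_mult_distr_l_reverse; apply Ropp_le_contravar.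
        apply Rmult_le_compat_l; [lra|]; apply Rinv_le_contravar; lra. }
      replace (INR m - INR i) with
        ((INR m + INR i + 1) * (1 + - (2 * INR i + 1) / (INR m + INR i + 1))) by (field; lra).
      apply Rmult_le_compat_l; [lra | exact H1]. }
    apply (Rmult_le_reg_r (INR m + INR i + 1)); [lra|].
    rewrite E.
    eapply Rle_trans; [apply Rmult_le_compat_l; [apply walk_nonneg | exact He]|].
    replace (walk m 0 * (exp (- INR i ^ 2 / (INR m + INR J)) * e) * (INR m + INR i + 1))
      with ((walk m 0 * exp (- INR i ^ 2 / (INR m + INR J))) * ((INR m + INR i + 1) * e)) by ring.
    apply Rmult_le_compat_r; [|exact IH].
    apply Rmult_le_pos; [lra | left; apply exp_pos].
Qed.

Lemma exp_opp_le_inv (y : R) : 0 <= y -> exp (- y) <= / (1 + y).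
Proof.
  intros Hy; rewrite exp_Ropp; apply Rinv_le_contravar; [lra | apply exp_ineq1_le].
Qed.

(** The counterpart of [walk_le]: the inverse quotient is [1 + (2i + 1) / (m - i)], at most
    [exp ((2i + 1) / (m - J + 1))], since [i + 1 <= J] gives [m - i >= m - J + 1]. *)
Lemma walk_ge (m J : nat) (i : nat) : (i <= J)%nat -> (J <= m)%nat ->
  walk m 0 * exp (- (INR i)^2 / (INR m - INR J + 1)) <= walk m (Z.of_nat i).
Proof.
  intros HiJ HmJ; apply le_INR in HmJ.
  induction i as [|i IH].
  - right. simpl (INR 0). replace (- 0 ^ 2 / (INR m - INR J + 1)) with 0 by (field; lra).
    rewrite exp_0, Rmult_1_r; reflexivity.
  - specialize (IH ltac:(lia)).
    pose proof (walk_ratio m (Z.of_nat i)) as E.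
    replace (Z.of_nat (S i)) with (Z.of_nat i + 1)%Z by lia.
    rewrite <- INR_IZR_INZ in E.
    apply le_INR in HiJ; rewrite S_INR in HiJ.
    pose proof (pos_INR i) as Pi.
    set (e := exp (- (2 * INR i + 1) / (INR m - INR J + 1))).
    assert (Ee : exp (- INR (S i) ^ 2 / (INR m - INR J + 1)) =
                 exp (- INR i ^ 2 / (INR m - INR J + 1)) * e).
    { unfold e; rewrite <- exp_plus; f_equal; rewrite S_INR; field; lra. }
    rewrite Ee.
    assert (He : (INR m + INR i + 1) * e <= INR m - INR i).
    { assert (H1 : e <= / (1 + (2 * INR i + 1) / (INR m - INR i))).
      { eapply Rle_trans; [|apply exp_opp_le_inv].
        - apply exp_le_compat.
          unfold Rdiv; rewrite !Ropp_mult_distr_l_reverse; apply Ropp_le_contravar.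
          apply Rmult_le_compat_l; [lra|]; apply Rinv_le_contravar; lra.
        - apply Rmult_le_pos; [lra|]; left; apply Rinv_0_lt_compat; lra. }
      replace (INR m - INR i) with
        ((INR m + INR i + 1) * / (1 + (2 * INR i + 1) / (INR m - INR i))) at 1 by (field; lra).
      apply Rmult_le_compat_l; [lra | exact H1]. }
    apply (Rmult_le_reg_r (INR m + INR i + 1)); [lra|].
    rewrite E.
    eapply Rle_trans; [|apply Rmult_le_compat_l; [apply walk_nonneg | exact He]].
    replace (walk m 0 * (exp (- INR i ^ 2 / (INR m - INR J + 1)) * e) * (INR m + INR i + 1))
      with ((walk m 0 * exp (- INR i ^ 2 / (INR m - INR J + 1))) * ((INR m + INR i + 1) * e)) by ring.
    apply Rmult_le_compat_r; [|exact IH].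
    apply Rmult_le_pos; [lra | left; apply exp_pos].
Qed.

(* Wallis: the limit exists by monotonicity; its value is not needed. *)
Lemma walk_0_asymptotic : exists K : R, is_lim_seq (fun m => sqrt (INR m) * walk m 0) K.
Proof.
  apply (ex_finite_lim_seq_incr _ 1).
  - intros m; rewrite walk_0_S, S_INR.
    pose proof (pos_INR m) as Pm; pose proof (walk_0_pos m) as Pw.
    rewrite (Rmult_comm (sqrt (INR m))), (Rmult_comm (sqrt (INR m + 1))), Rmult_assoc.
    apply Rmult_le_compat_l; [lra|]; rewrite (Rmult_comm (_ / _)).
    replace ((2 * INR m + 1) / (2 * INR m + 2))
      with (sqrt (((2 * INR m + 1) / (2 * INR m + 2))^2)).
    2: { apply sqrt_pow2. apply Rmult_le_pos; [lra|]; left; apply Rinv_0_lt_compat; lra. }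
    rewrite <- sqrt_mult by (try lra; apply pow2_ge_0).
    apply sqrt_le_1_alt.
    replace ((INR m + 1) * ((2 * INR m + 1) / (2 * INR m + 2)) ^ 2)
      with (INR m + / (4 * (INR m + 1))) by (field; lra).
    assert (0 < / (4 * (INR m + 1))) by (apply Rinv_0_lt_compat; lra).
    lra.
  - intros m; pose proof (pos_INR m) as Pm; pose proof (walk_0_pos m) as Pw.
    (* The slightly stronger quantity with [2m + 1] is the one that decreases, because
       [(2m + 3) (2m + 1) <= (2m + 2)^2]. *)
    assert (B : (2 * INR m + 1) * (walk m 0)^2 <= 1).
    { clear Pm Pw; induction m as [|m IH]; [simpl; lra|].
      rewrite walk_0_S, S_INR; pose proof (pos_INR m) as Pm.
      replace ((2 * (INR m + 1) + 1) * (walk m 0 * ((2 * INR m + 1) / (2 * INR m + 2))) ^ 2)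
        with (((2 * INR m + 1) * (walk m 0)^2) *
              (((2 * INR m + 3) * (2 * INR m + 1)) / (2 * INR m + 2)^2)) by (field; lra).
      apply Rle_trans with (1 * 1); [|lra]; apply Rmult_le_compat; try exact IH.
      - apply Rmult_le_pos; [lra | apply pow2_ge_0].
      - apply Rmult_le_pos; [nra | left; apply Rinv_0_lt_compat; nra].
      - apply Rle_div_l; nra. }
    apply Rsqr_incr_0_var; [|lra].
    unfold Rsqr.
    replace (sqrt (INR m) * walk m 0 * (sqrt (INR m) * walk m 0))
      with ((sqrt (INR m) * sqrt (INR m)) * (walk m 0)^2) by ring.
    rewrite sqrt_sqrt by exact Pm.
    pose proof (pow2_ge_0 (walk m 0)); nra.
Qed.

(** * Cosine sums and the binomial weights folded modulo [2n + 1] *)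

Lemma symsum_0 (f : Z -> R) (K : nat) :
  (forall k, (Z.abs k <= Z.of_nat K)%Z -> f k = 0) -> symsum f K = 0.
Proof.
  intros H; rewrite (symsum_ext f (fun k => 0 * 0)).
  - rewrite symsum_scal; ring.
  - intros k Hk; rewrite H by exact Hk; ring.
Qed.

Lemma symsum_single (f : Z -> R) (k0 : Z) (K : nat) :
  (Z.abs k0 <= Z.of_nat K)%Z -> (forall k, k <> k0 -> f k = 0) -> symsum f K = f k0.
Proof.
  intros Hk0 H; induction K as [|K IH].
  - replace k0 with 0%Z by lia; reflexivity.
  - rewrite symsum_S.
    destruct (Z_le_dec (Z.abs k0) (Z.of_nat K)) as [L|L].
    + rewrite IH, (H (Z.of_nat (S K))), (H (- Z.of_nat (S K))%Z) by lia; ring.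
    + rewrite symsum_0 by (intros k Hk; apply H; lia).
      destruct (Z_le_dec 0 k0) as [P|P].
      * replace (Z.of_nat (S K)) with k0 by lia.
        rewrite (H (- k0)%Z) by lia; ring.
      * replace (Z.of_nat (S K)) with (- k0)%Z by lia.
        rewrite (H (- k0)%Z), Z.opp_involutive by lia; ring.
Qed.

(** Multiplication by [sin (x / 2)] turns each pair of cosines into a difference of sines at
    half-integers, so the sum telescopes. Keeping the factor on the left avoids excluding its
    zeros. *)
Lemma Dirichlet_kernel (x : R) (n : nat) :
  sin (x / 2) * symsum (fun j => cos (IZR j * x)) n = sin ((INR n + 1 / 2) * x).
Proof.
  induction n as [|n IH].
  - unfold symsum; simpl; rewrite Rmult_0_l, cos_0, Rmult_1_r; f_equal; lra.
  - rewrite symsum_S, Rmult_plus_distr_l, IH, opp_IZR, <- INR_IZR_INZ.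
    rewrite Ropp_mult_distr_l_reverse, cos_neg.
    replace ((INR (S n) + 1 / 2) * x) with (INR (S n) * x + x / 2) by field.
    replace ((INR n + 1 / 2) * x) with (INR (S n) * x - x / 2) by (rewrite S_INR; field).
    rewrite sin_plus, sin_minus; ring.
Qed.

Lemma sin_IZR_PI (k : Z) : sin (IZR k * PI) = 0.
Proof. apply sin_eq_0_1; exists k; reflexivity. Qed.

(** Orthogonality of the characters modulo [l = 2n + 1] in real form. With [x = 2 PI i / l] the
    Dirichlet numerator is [sin (i PI) = 0], so the sum vanishes unless [sin (x / 2) = 0], which
    means that [l] divides [i]. *)
Lemma cos_orthogonality (n : nat) (i : Z) :
  symsum (fun j => cos (2 * IZR i * (PI * IZR j / INR (2 * n + 1)))) n =
  if Z.eq_dec (i mod Z.of_nat (2 * n + 1)) 0 then INR (2 * n + 1) else 0.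
Proof.
  assert (Hl : 0 < INR (2 * n + 1)) by (apply lt_0_INR; lia).
  destruct (Z.eq_dec _ 0) as [H|H].
  - apply Z.mod_divide in H; [|lia]; destruct H as [q ->].
    rewrite (symsum_ext _ (fun _ => 1 * 1)).
    + rewrite symsum_scal; unfold symsum; rewrite sum_cte.
      replace (S (2 * n)) with (2 * n + 1)%nat by lia; ring.
    + intros j _.
      rewrite mult_IZR, <- INR_IZR_INZ.
      replace (2 * (IZR q * INR (2 * n + 1)) * (PI * IZR j / INR (2 * n + 1)))
        with (2 * (IZR (q * j) * PI)) by (rewrite mult_IZR; field; lra).
      rewrite cos_2a_sin, sin_IZR_PI; ring.
  - set (x := 2 * IZR i * PI / INR (2 * n + 1)).
    pose proof (Dirichlet_kernel x n) as D.
    replace ((INR n + 1 / 2) * x) with (IZR i * PI) in D.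
    2: { unfold x; rewrite plus_INR, mult_INR in *; simpl INR in *; field; lra. }
    rewrite sin_IZR_PI in D.
    rewrite (symsum_ext _ (fun j => cos (IZR j * x))).
    2: { intros j _; f_equal; unfold x; field; lra. }
    apply Rmult_integral in D; destruct D as [D|D]; [|exact D].
    exfalso; apply H; apply sin_eq_0_0 in D; destruct D as [q Hq].
    apply Z.mod_divide; [lia|]; exists q; apply eq_IZR.
    rewrite mult_IZR, <- INR_IZR_INZ.
    unfold x in Hq.
    apply (Rmult_eq_reg_r (PI / INR (2 * n + 1))).
    + transitivity (2 * IZR i * PI / INR (2 * n + 1) / 2); [field; lra|].
      rewrite Hq; field; lra.
    + pose proof PI_RGT_0; apply Rgt_not_eq, Rdiv_lt_0_compat; lra.
Qed.

(* Both sides solve the same heat recurrence in [m], with the same initial data on the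
   window that influences the value at [i]. *)
Lemma walk_fold (n K m : nat) : forall i : Z,
  (Z.abs i + Z.of_nat m <= Z.of_nat K * Z.of_nat (2 * n + 1))%Z ->
  INR (2 * n + 1) * symsum (fun k => walk m (i + k * Z.of_nat (2 * n + 1))) K =
  symsum (fun j => cos (PI * IZR j / INR (2 * n + 1)) ^ (2 * m) *
                   cos (2 * IZR i * (PI * IZR j / INR (2 * n + 1)))) n.
Proof.
  set (l := (2 * n + 1)%nat) in *.
  assert (Hl : (0 < Z.of_nat l)%Z) by lia.
  induction m as [|m IH]; intros i Hi.
  - rewrite (symsum_ext (fun j => cos (PI * IZR j / INR l) ^ (2 * 0) * _)
              (fun j => cos (2 * IZR i * (PI * IZR j / INR l)))) by (intros; simpl; ring).
    pose proof (cos_orthogonality n i) as O; fold l in O; rewrite O; clear O.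
    destruct (Z.eq_dec (i mod Z.of_nat l) 0) as [H|H].
    + apply Z.mod_divide in H; [|lia]; destruct H as [q ->].
      rewrite (symsum_single _ (- q)%Z).
      * simpl; destruct (Z.eq_dec _ 0); [ring | lia].
      * nia.
      * intros k Hk; simpl; destruct (Z.eq_dec _ 0) as [E|E]; [|reflexivity].
        exfalso; apply Hk; nia.
    + rewrite symsum_0; [ring|].
      intros k _; simpl; destruct (Z.eq_dec _ 0) as [E|E]; [|reflexivity].
      exfalso; apply H, Z.mod_divide; [lia|]; exists (- k)%Z; lia.
  - pose proof (IH (i - 1)%Z ltac:(lia)) as E1; pose proof (IH i ltac:(lia)) as E2;
      pose proof (IH (i + 1)%Z ltac:(lia)) as E3; clear IH.
    set (F := fun i' j => cos (PI * IZR j / INR l) ^ (2 * m) *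
                          cos (2 * IZR i' * (PI * IZR j / INR l))).
    change (INR l * symsum (fun k => walk m (i - 1 + k * Z.of_nat l)) K = symsum (F (i - 1)%Z) n) in E1.
    change (INR l * symsum (fun k => walk m (i + k * Z.of_nat l)) K = symsum (F i) n) in E2.
    change (INR l * symsum (fun k => walk m (i + 1 + k * Z.of_nat l)) K = symsum (F (i + 1)%Z) n) in E3.
    rewrite (symsum_ext (fun k => walk (S m) (i + k * Z.of_nat l))
      (fun k => / 4 * (walk m (i - 1 + k * Z.of_nat l) +
                (2 * walk m (i + k * Z.of_nat l) + walk m (i + 1 + k * Z.of_nat l))))).
    2: { intros k _; rewrite walk_S.
         replace (i + k * Z.of_nat l - 1)%Z with (i - 1 + k * Z.of_nat l)%Z by lia.
         replace (i + k * Z.of_nat l + 1)%Z with (i + 1 + k * Z.of_nat l)%Z by lia. field. }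
    rewrite (symsum_ext (fun j => cos (PI * IZR j / INR l) ^ (2 * S m) * _)
      (fun j => / 4 * (F (i - 1)%Z j + (2 * F i j + F (i + 1)%Z j)))).
    + rewrite !symsum_scal, !symsum_plus, !symsum_scal, <- E1, <- E2, <- E3; ring.
    (* Averaging [cos (2 i y)] over the three neighbours with weights 1/4, 1/2, 1/4 multiplies it by
       [(1 + cos (2 y)) / 2 = cos y ^ 2]: the cosines are eigenvectors of the step of [walk]. *)
    + intros j _; unfold F; set (y := PI * IZR j / INR l).
      rewrite minus_IZR, plus_IZR.
      replace (2 * (IZR i - 1) * y) with (2 * IZR i * y - 2 * y) by ring.
      replace (2 * (IZR i + 1) * y) with (2 * IZR i * y + 2 * y) by ring.
      rewrite cos_minus, cos_plus, cos_2a_cos.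
      replace (2 * S m)%nat with (2 + 2 * m)%nat by lia; rewrite pow_add; field.
Qed.

(** At [i = 0], [walk_fold] gives the same value for every [K >= m], so the symmetric partial sums
    are eventually constant. *)
Lemma walk_Poisson (n m : nat) :
  ex_series (zfold (fun k => walk m (k * Z.of_nat (2 * n + 1)))) /\
  INR (2 * n + 1) * ZSeries (fun k => walk m (k * Z.of_nat (2 * n + 1))) =
  symsum (fun j => cos (PI * IZR j / INR (2 * n + 1)) ^ (2 * m)) n.
Proof.
  set (l := (2 * n + 1)%nat).
  assert (Hl : 0 < INR l) by (apply lt_0_INR; lia).
  set (S0 := symsum (fun j => cos (PI * IZR j / INR l) ^ (2 * m)) n).
  assert (E : forall K, (m <= K)%nat -> S0 / INR l = symsum (fun k => walk m (k * Z.of_nat l)) K).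
  { intros K HK.
    pose proof (walk_fold n K m 0) as W; fold l in W.
    unfold S0; rewrite (symsum_ext _ (fun j => cos (PI * IZR j / INR l) ^ (2 * m) *
                   cos (2 * IZR 0 * (PI * IZR j / INR l)))).
    - rewrite <- W by nia.
      field_simplify; [|lra]. apply symsum_ext; intros k _; f_equal; lia.
    - intros j _; rewrite Rmult_0_r, Rmult_0_l, cos_0; ring. }
  destruct (ZSeries_eq_of_is_lim (fun k => walk m (k * Z.of_nat l)) (S0 / INR l)) as [H1 H2].
  - apply (is_lim_seq_ext_loc (fun _ => S0 / INR l)); [|apply is_lim_seq_const].
    exists m; exact E.
  - split; [exact H1|]. rewrite H2; field; lra.
Qed.

(** * Jacobi's identity *)

Lemma is_lim_seq_exp (u : nat -> R) (l : R) :
  is_lim_seq u l -> is_lim_seq (fun n => exp (u n)) (exp l).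
Proof.
  apply is_lim_seq_continuous, derivable_continuous_pt, derivable_pt_exp.
Qed.

Lemma is_lim_seq_exp_opp (u : nat -> R) (l : R) :
  is_lim_seq u l -> is_lim_seq (fun n => exp (- u n)) (exp (- l)).
Proof. intros H; apply is_lim_seq_exp, (is_lim_seq_opp u l), H. Qed.

Lemma is_lim_inv_odd : is_lim_seq (fun n => / INR (2 * n + 1)) 0.
Proof.
  apply (is_lim_seq_le_le (fun _ => 0) _ (fun n => / INR (S n))).
  - intros n; split.
    + left; apply Rinv_0_lt_compat, lt_0_INR; lia.
    + apply Rinv_le_contravar; [apply lt_0_INR; lia | apply le_INR; lia].
  - apply is_lim_seq_const.
  - apply (is_lim_seq_incr_1 (fun n => / INR n)).
    change (Finite 0) with (Rbar_inv p_infty).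
    apply is_lim_seq_inv; [apply is_lim_seq_INR | discriminate].
Qed.

Lemma is_lim_floor_ratio (A : R) (m : nat -> nat) :
  (forall n, INR (m n) <= A * INR (2 * n + 1) ^ 2 < INR (m n) + 1) ->
  is_lim_seq (fun n => INR (m n) * (/ INR (2 * n + 1)) ^ 2) A.
Proof.
  intros Hm.
  apply (is_lim_seq_le_le (fun n => A - / INR (2 * n + 1) * / INR (2 * n + 1)) _ (fun _ => A)).
  - intros n; destruct (Hm n) as [H1 H2].
    assert (Hl : 0 < INR (2 * n + 1)) by (apply lt_0_INR; lia).
    set (l := INR (2 * n + 1)) in *.
    assert (Hi : 0 < / l) by (apply Rinv_0_lt_compat, Hl).
    assert (E : A = A * l ^ 2 * (/ l) ^ 2) by (field; lra).
    assert (0 < (/ l)^2) by (apply pow_lt, Hi).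
    split.
    + rewrite E at 1; nra.
    + rewrite E; apply Rmult_le_compat_r; lra.
  - replace (Finite A) with (Finite (A - 0 * 0)) by (f_equal; ring).
    apply is_lim_seq_minus'; [apply is_lim_seq_const|].
    apply is_lim_seq_mult'; apply is_lim_inv_odd.
  - apply is_lim_seq_const.
Qed.

Lemma Rabs_IZR_nat (k : Z) : Rabs (IZR k) = INR (Z.abs_nat k).
Proof. rewrite <- abs_IZR, INR_IZR_INZ; f_equal; lia. Qed.

Lemma IZR_sqr_nat (k : Z) : IZR k ^ 2 = INR (Z.abs_nat k) ^ 2.
Proof. rewrite <- Rabs_IZR_nat, pow2_abs; reflexivity. Qed.

Lemma nat_le_sqr (p : nat) : INR p <= INR p ^ 2.
Proof.
  rewrite <- pow_INR; apply le_INR; simpl; nia.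
Qed.

Lemma gauss_le_zexp (c : R) (k : Z) : 0 <= c -> exp (- (c * IZR k ^ 2)) <= zexp c k.
Proof.
  intros Hc; unfold zexp; apply exp_le_compat.
  rewrite IZR_sqr_nat, Rabs_IZR_nat.
  pose proof (nat_le_sqr (Z.abs_nat k)); nra.
Qed.

Lemma theta3_term_le (s : R) (k : Z) :
  0 < s -> Rabs (theta3_term s k) <= 1 * zexp (PI * s) k.
Proof.
  intros Hs; pose proof PI_RGT_0.
  unfold theta3_term; rewrite Rabs_pos_eq by (left; apply exp_pos).
  replace (- PI * IZR k ^ 2 * s) with (- (PI * s * IZR k ^ 2)) by ring.
  rewrite Rmult_1_l; apply gauss_le_zexp; nra.
Qed.

Lemma theta3_term_summable (s : R) : 0 < s -> ex_series (zfold (theta3_term s)).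
Proof.
  intros Hs; pose proof PI_RGT_0.
  apply (ex_zfold_of_zexp _ (PI * s) 1); [nra|].
  intros k; apply theta3_term_le, Hs.
Qed.

Lemma theta3_ZSeries (s : R) : 0 < s -> theta3 s = ZSeries (theta3_term s).
Proof. intros Hs; apply zsum_ZSeries, theta3_term_summable, Hs. Qed.

(** Division by the central weight leaves pure Gaussian quotients. Both [walk_le] and [walk_ge] are
    used with [J = |k| l], and [J / l^2] tends to [0], so the two bounds have the same limit. *)
Lemma walk_limit (t : R) (m : nat -> nat) :
  0 < t ->
  (forall n, INR (m n) <= / (PI * t) * INR (2 * n + 1) ^ 2 < INR (m n) + 1) ->
  is_lim_seq (fun n => ZSeries (fun k => / walk (m n) 0 * walk (m n) (k * Z.of_nat (2 * n + 1))))
             (theta3 t).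
Proof.
  intros Ht Hm; pose proof PI_RGT_0 as HPI.
  set (A := / (PI * t)) in *.
  assert (HA : 0 < A) by (apply Rinv_0_lt_compat; nra).
  pose proof (is_lim_floor_ratio A m Hm) as Lc.
  pose proof is_lim_inv_odd as Le.
  rewrite (theta3_ZSeries t Ht).
  assert (Eabs : forall n k, walk (m n) (k * Z.of_nat (2 * n + 1)) =
                 walk (m n) (Z.of_nat (Z.abs_nat k * (2 * n + 1)))).
  { intros n k; destruct (Z_le_dec 0 k).
    - f_equal; lia.
    - rewrite <- walk_opp; f_equal; lia. }
  set (c := fun n => INR (m n) * (/ INR (2 * n + 1)) ^ 2) in *.
  assert (Lpos : forall n, 0 < INR (2 * n + 1)) by (intros n; apply lt_0_INR; lia).
  assert (cle : forall n, 0 <= c n <= A).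
  { intros n; destruct (Hm n) as [H1 _]; specialize (Lpos n); unfold c.
    assert (Hi : 0 < (/ INR (2 * n + 1))^2) by (apply pow_lt, Rinv_0_lt_compat, Lpos).
    split; [apply Rmult_le_pos; [apply pos_INR | lra]|].
    replace A with (A * INR (2 * n + 1) ^ 2 * (/ INR (2 * n + 1))^2) by (field; lra).
    apply Rmult_le_compat_r; lra. }
  assert (cpos : eventually (fun n => 0 < c n)).
  { apply is_lim_seq_spec in Lc; destruct (Lc (mkposreal A HA)) as [N HN]; exists N.
    intros n Hn; specialize (HN n Hn); cbn [pos] in HN; apply Rabs_def2 in HN; lra. }
  assert (upper : forall n k, 0 < c n -> / walk (m n) 0 * walk (m n) (k * Z.of_nat (2 * n + 1)) <=
                   exp (- IZR k ^ 2 / (c n + INR (Z.abs_nat k) * / INR (2 * n + 1)))).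
  { intros n k Hc; rewrite Eabs; pose proof (walk_0_pos (m n)) as W.
    (* At [k = 0] one has [J = 0], so the side condition [0 < m + J] of [walk_le] must come from
       [m n] alone. *)
    assert (Hmn : (0 < m n)%nat).
    { destruct (Nat.eq_dec (m n) 0) as [E0|]; [|lia].
      unfold c in Hc; rewrite E0 in Hc; simpl (INR 0) in Hc; lra. }
    apply (Rmult_le_reg_l (walk (m n) 0)); [exact W|].
    rewrite <- Rmult_assoc, Rinv_r, Rmult_1_l by lra.
    eapply Rle_trans; [apply (walk_le _ _ _ (le_n _)); lia|].
    right; do 2 f_equal; rewrite IZR_sqr_nat, mult_INR; unfold c.
    specialize (Lpos n); pose proof (pos_INR (Z.abs_nat k)).
    apply lt_INR in Hmn; simpl (INR 0) in Hmn.
    field; repeat split; nra. }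
  (* With [p = |k|] and [e = 1 / l <= 1], one has [c n + p e <= A + p], so for [p >= 1] the Gaussian
     exponent [p^2 / (c n + p e)] is at least [p / (A + 1)]. Only exponential decay survives, as the
     bound of [walk_le] is Gaussian only for [p l] small against [m]. *)
  apply (ZSeries_dominated _ _ (fun k => 1 * zexp (/ (A + 1)) k)).
  - apply ex_zfold_scal, ex_zfold_zexp, Rinv_0_lt_compat; lra.
  - destruct cpos as [N HN]; exists N; intros n Hn k; specialize (HN n Hn).
    rewrite Rabs_pos_eq.
    2: { apply Rmult_le_pos; [left; apply Rinv_0_lt_compat, walk_0_pos | apply walk_nonneg]. }
    eapply Rle_trans; [apply upper, HN|].
    rewrite Rmult_1_l; unfold zexp; apply exp_le_compat.
    rewrite IZR_sqr_nat, Rabs_IZR_nat; destruct (cle n) as [_ cl].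
    assert (He : 0 < / INR (2 * n + 1) <= 1).
    { specialize (Lpos n); split; [apply Rinv_0_lt_compat, Lpos|].
      rewrite <- Rinv_1; apply Rinv_le_contravar; [lra|].
      apply (le_INR 1); lia. }
    set (p := Z.abs_nat k); set (e := / INR (2 * n + 1)) in *.
    unfold Rdiv; rewrite !Ropp_mult_distr_l_reverse; apply Ropp_le_contravar.
    pose proof (nat_le_sqr p) as Hp; pose proof (pos_INR p) as Hp0.
    assert (D : 0 < c n + INR p * e).
    { apply Rplus_lt_le_0_compat; [exact HN | apply Rmult_le_pos; lra]. }
    apply (Rmult_le_reg_r ((A + 1) * (c n + INR p * e))); [apply Rmult_lt_0_compat; lra|].
    replace (/ (A + 1) * INR p * ((A + 1) * (c n + INR p * e)))
      with (INR p * (c n + INR p * e)) by (field; lra).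
    replace (INR p ^ 2 * / (c n + INR p * e) * ((A + 1) * (c n + INR p * e)))
      with (INR p ^ 2 * (A + 1)) by (field; lra).
    assert (INR p * c n <= INR p ^ 2 * A) by (apply Rmult_le_compat; lra).
    assert (INR p ^ 2 * e <= INR p ^ 2 * 1) by (apply Rmult_le_compat_l; nra).
    nra.
  - intros k; set (p := Z.abs_nat k).
    assert (E : theta3_term t k = exp (- INR p ^ 2 / A)).
    { unfold theta3_term, A, p; rewrite IZR_sqr_nat; f_equal; field; lra. }
    rewrite E.
    (* The lower denominator is [(m - J + 1) / l^2] with [J = p l]; the last summand is the [+ 1] of
       [walk_ge]. *)
    apply (is_lim_seq_le_le_loc
      (fun n => exp (- INR p ^ 2 / (c n - INR p * / INR (2 * n + 1) + / INR (2 * n + 1) * / INR (2 * n + 1)))) _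
      (fun n => exp (- INR p ^ 2 / (c n + INR p * / INR (2 * n + 1))))).
    + assert (Lp : is_lim_seq (fun n => INR p * / INR (2 * n + 1)) 0).
      { replace (Finite 0) with (Rbar_mult (INR p) 0) by (simpl; f_equal; ring).
        apply is_lim_seq_scal_l, Le. }
      pose proof (is_lim_seq_minus' _ _ _ _ Lc Lp) as L1.
      apply is_lim_seq_spec in L1; rewrite Rminus_0_r in L1.
      destruct (L1 (mkposreal A HA)) as [N HN]; cbn [pos] in HN.
      destruct cpos as [N' HN'].
      exists (max N N'); intros n Hn; specialize (HN n ltac:(lia)); specialize (HN' n ltac:(lia)).
      apply Rabs_def2 in HN.
      split; [|unfold p; rewrite <- IZR_sqr_nat; apply upper, HN'].
      rewrite Eabs; fold p; pose proof (walk_0_pos (m n)) as W.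
      specialize (Lpos n).
      assert (Hlt : INR p * INR (2 * n + 1) < INR (m n)).
      { assert (G : 0 < (c n - INR p * / INR (2 * n + 1)) * INR (2 * n + 1)^2)
          by (apply Rmult_lt_0_compat; [lra | apply pow_lt, Lpos]).
        replace ((c n - INR p * / INR (2 * n + 1)) * INR (2 * n + 1)^2)
          with (INR (m n) - INR p * INR (2 * n + 1)) in G by (unfold c; field; lra).
        lra. }
      rewrite <- mult_INR in Hlt; apply INR_lt in Hlt.
      apply (Rmult_le_reg_l (walk (m n) 0)); [exact W|].
      rewrite <- (Rmult_assoc _ (/ _)), Rinv_r, Rmult_1_l by lra.
      eapply Rle_trans; [|apply (walk_ge _ _ _ (le_n _)); lia].
      right; do 2 f_equal; rewrite mult_INR; unfold c.
      apply lt_INR in Hlt; rewrite mult_INR in Hlt.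
      field; split; nra.
    + apply is_lim_seq_exp, is_lim_seq_div'; [apply is_lim_seq_const | | lra].
      replace A with (A - INR p * 0 + 0 * 0) by ring.
      apply is_lim_seq_plus'; [apply is_lim_seq_minus'; [exact Lc|] | apply is_lim_seq_mult'; exact Le].
      apply is_lim_seq_mult'; [apply is_lim_seq_const | exact Le].
    + apply is_lim_seq_exp, is_lim_seq_div'; [apply is_lim_seq_const | | lra].
      replace A with (A + INR p * 0) by ring.
      apply is_lim_seq_plus'; [exact Lc|].
      apply is_lim_seq_mult'; [apply is_lim_seq_const | exact Le].
Qed.

(** * The limit of the cosine sum *)

Lemma sin_ge_cubic (x : R) : 0 <= x <= 4 -> x - x ^ 3 / 6 <= sin x.
Proof.
  intros [H0 H1]; destruct (pre_sin_bound x 0 H0 H1) as [H _].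
  eapply Rle_trans; [|exact H].
  right; unfold sin_approx, sin_term; simpl; field.
Qed.

Lemma sin_le_id (x : R) : 0 <= x -> sin x <= x.
Proof.
  intros [H|<-]; [left; apply sin_lt_x, H | rewrite sin_0; lra].
Qed.

Lemma cos_pow_le (x : R) (m : nat) : cos x ^ (2 * m) <= exp (- (INR m * sin x ^ 2)).
Proof.
  rewrite pow_mult.
  replace (- (INR m * sin x ^ 2)) with (INR m * (- sin x ^ 2)) by ring.
  rewrite exp_nat_mul; apply pow_incr; split; [apply pow2_ge_0|].
  pose proof (exp_ineq1_le (- sin x ^ 2)); pose proof (sin2_cos2 x); unfold Rsqr in *; lra.
Qed.

(** The exponent [y = x^2 / (1 - x^2)] is chosen so that [1 / (1 + y) = 1 - x^2], which is at most
    [1 - sin x ^ 2]. *)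
Lemma cos_pow_ge (x : R) (m : nat) : 0 <= x < 1 ->
  exp (- (INR m * (x ^ 2 / (1 - x ^ 2)))) <= cos x ^ (2 * m).
Proof.
  intros Hx; rewrite pow_mult.
  replace (- (INR m * (x ^ 2 / (1 - x ^ 2)))) with (INR m * (- (x ^ 2 / (1 - x ^ 2)))) by ring.
  rewrite exp_nat_mul; apply pow_incr; split; [left; apply exp_pos|].
  assert (D : 0 < 1 - x ^ 2) by nra.
  eapply Rle_trans; [apply exp_opp_le_inv|].
  - apply Rmult_le_pos; [apply pow2_ge_0 | left; apply Rinv_0_lt_compat, D].
  - replace (/ (1 + x ^ 2 / (1 - x ^ 2))) with (1 - x ^ 2) by (field; lra).
    assert (S : sin x <= x) by (apply sin_le_id; lra).
    assert (0 <= sin x) by (apply sin_ge_0; [|pose proof PI2_3_2]; lra).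
    pose proof (sin2_cos2 x); unfold Rsqr in *; nra.
Qed.

(** Extension by zero turns a sum whose range grows with [n] into a sum over a fixed range, the form
    that dominated convergence needs. *)
Lemma symsum_trunc (f : Z -> R) (n : nat) :
  ZSeries (fun k => if Z_le_dec (Z.abs k) (Z.of_nat n) then f k else 0) = symsum f n.
Proof.
  apply ZSeries_eq_of_is_lim.
  apply (is_lim_seq_ext_loc (fun _ => symsum f n)); [|apply is_lim_seq_const].
  exists n; intros N HN; induction HN as [|N HN IH].
  - apply symsum_ext; intros k Hk; destruct (Z_le_dec _ _); [reflexivity | lia].
  - rewrite symsum_S, <- IH.
    destruct (Z_le_dec (Z.abs (Z.of_nat (S N))) (Z.of_nat n)); [lia|].
    destruct (Z_le_dec (Z.abs (- Z.of_nat (S N))) (Z.of_nat n)); [lia|]. ring.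
Qed.

Lemma cos_limit (t : R) (m : nat -> nat) :
  0 < t ->
  (forall n, INR (m n) <= / (PI * t) * INR (2 * n + 1) ^ 2 < INR (m n) + 1) ->
  is_lim_seq (fun n => symsum (fun j => cos (PI * IZR j / INR (2 * n + 1)) ^ (2 * m n)) n)
             (theta3 (/ t)).
Proof.
  intros Ht Hm; pose proof PI_RGT_0 as HPI.
  set (A := / (PI * t)) in *.
  assert (HA : 0 < A) by (apply Rinv_0_lt_compat; nra).
  pose proof (is_lim_floor_ratio A m Hm) as Lc.
  pose proof is_lim_inv_odd as Le.
  assert (Hti : 0 < / t) by (apply Rinv_0_lt_compat, Ht).
  rewrite (theta3_ZSeries _ Hti).
  set (c := fun n => INR (m n) * (/ INR (2 * n + 1)) ^ 2) in *.
  assert (Lpos : forall n, 0 < INR (2 * n + 1)) by (intros n; apply lt_0_INR; lia).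
  assert (chalf : eventually (fun n => A / 2 <= c n)).
  { apply is_lim_seq_spec in Lc; assert (HA2 : 0 < A / 2) by lra.
    destruct (Lc (mkposreal _ HA2)) as [N HN]; exists N.
    intros n Hn; specialize (HN n Hn); cbn [pos] in HN; apply Rabs_def2 in HN; lra. }
  apply (is_lim_seq_ext (fun n => ZSeries (fun j => if Z_le_dec (Z.abs j) (Z.of_nat n) then
           cos (PI * IZR j / INR (2 * n + 1)) ^ (2 * m n) else 0))).
  { intros n; apply symsum_trunc. }
  assert (Ecos : forall n j, cos (PI * IZR j / INR (2 * n + 1)) =
                 cos (PI * INR (Z.abs_nat j) * / INR (2 * n + 1))).
  { intros n j; rewrite <- Rabs_IZR_nat; unfold Rabs; destruct (Rcase_abs (IZR j)).
    - rewrite <- cos_neg; f_equal; unfold Rdiv; ring.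
    - reflexivity. }
  assert (Hx : forall n j, 0 <= PI * INR (Z.abs_nat j) * / INR (2 * n + 1)).
  { intros n j; apply Rmult_le_pos; [|left; apply Rinv_0_lt_compat, Lpos].
    apply Rmult_le_pos; [lra | apply pos_INR]. }
  (* For [|j| <= n] the angle [x = PI |j| / l] is at most [2], so [sin x >= x - x^3 / 6 >= x / 3].
     This is the source of the [9]; the [A / 2] is the eventual lower bound of [m / l^2]. *)
  apply (ZSeries_dominated _ _ (fun j => 1 * zexp (A / 2 * PI ^ 2 / 9) j)).
  - apply ex_zfold_scal, ex_zfold_zexp.
    apply Rdiv_lt_0_compat; [|lra]; apply Rmult_lt_0_compat; [lra | apply pow_lt, HPI].
  - destruct chalf as [N HN]; exists N; intros n Hn j; specialize (HN n Hn).
    rewrite Rmult_1_l.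
    destruct (Z_le_dec _ _) as [Hj|Hj]; [|rewrite Rabs_R0; left; apply zexp_pos].
    rewrite Rabs_pos_eq by (rewrite pow_mult; apply pow_le, pow2_ge_0).
    eapply Rle_trans; [|apply gauss_le_zexp].
    2: { apply Rmult_le_pos; [apply Rmult_le_pos; [lra | apply pow2_ge_0] | lra]. }
    rewrite Ecos; eapply Rle_trans; [apply cos_pow_le|].
    apply exp_le_compat, Ropp_le_contravar; rewrite IZR_sqr_nat.
    set (p := Z.abs_nat j) in *; set (x := PI * INR p * / INR (2 * n + 1)).
    assert (Hx0 : 0 <= x) by apply (Hx n j).
    assert (Hx2 : x <= 2).
    { unfold x; apply Rle_div_l; [apply Lpos|].
      assert (Hpn : (2 * p <= 2 * n + 1)%nat) by lia.
      apply le_INR in Hpn; rewrite mult_INR in Hpn; simpl (INR 2) in Hpn.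
      pose proof PI_4; pose proof (pos_INR p); nra. }
    assert (Hs : x / 3 <= sin x).
    { eapply Rle_trans; [|apply sin_ge_cubic; lra].
      assert (x * (x * x) <= x * 4) by (apply Rmult_le_compat_l; nra).
      simpl; lra. }
    assert (Hs2 : x ^ 2 / 9 <= sin x ^ 2).
    { replace (x ^ 2 / 9) with ((x / 3) ^ 2) by field. apply pow_incr; lra. }
    apply Rle_trans with (INR (m n) * (x ^ 2 / 9)).
    + replace (INR (m n) * (x ^ 2 / 9)) with (c n * PI ^ 2 / 9 * INR p ^ 2)
        by (unfold c, x; field; specialize (Lpos n); lra).
      apply Rmult_le_compat_r; [apply pow2_ge_0|].
      apply Rmult_le_compat_r; [lra|]; apply Rmult_le_compat_r; [apply pow2_ge_0 | exact HN].
    + apply Rmult_le_compat_l; [apply pos_INR | exact Hs2].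
  - intros j; set (p := Z.abs_nat j).
    set (e := fun n => / INR (2 * n + 1)) in *.
    assert (E : theta3_term (/ t) j = exp (- (A * (PI * INR p) ^ 2))).
    { unfold theta3_term, A, p; rewrite IZR_sqr_nat; f_equal; field; lra. }
    rewrite E.
    assert (Lx : is_lim_seq (fun n => PI * INR p * e n) 0).
    { replace (Finite 0) with (Finite (PI * INR p * 0)) by (f_equal; ring).
      apply is_lim_seq_mult'; [apply is_lim_seq_const | exact Le]. }
    assert (Lx2 : is_lim_seq (fun n => (PI * INR p * e n) ^ 2) 0).
    { replace (Finite 0) with (Finite (0 * 0)) by (f_equal; ring).
      apply (is_lim_seq_ext (fun n => (PI * INR p * e n) * (PI * INR p * e n))); [intros n; ring|].
      apply is_lim_seq_mult'; exact Lx. }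
    assert (Lm : is_lim_seq (fun n => c n * (PI * INR p) ^ 2) (A * (PI * INR p) ^ 2)).
    { apply is_lim_seq_mult'; [exact Lc | apply is_lim_seq_const]. }
    apply (is_lim_seq_le_le_loc
      (fun n => exp (- (c n * (PI * INR p) ^ 2 / (1 - (PI * INR p * e n) ^ 2)))) _
      (fun n => exp (- (c n * (PI * INR p) ^ 2 *
         ((1 - (PI * INR p * e n) ^ 2 / 6) * (1 - (PI * INR p * e n) ^ 2 / 6)))))).
    + apply is_lim_seq_spec in Lx; destruct (Lx (mkposreal 1 Rlt_0_1)) as [N HN]; cbn [pos] in HN.
      (* From [p] on, [j] lies inside the truncated range; from [N] on, the angle is below [1], as
         [cos_pow_ge] requires. *)
      exists (max N p); intros n Hn; specialize (HN n ltac:(lia)).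
      destruct (Z_le_dec _ _) as [Hj|Hj]; [|lia].
      rewrite Ecos; fold p; specialize (Hx n j); fold p in Hx.
      change (/ INR (2 * n + 1)) with (e n) in *.
      apply Rabs_def2 in HN; rewrite Rminus_0_r in HN.
      assert (En : forall y, INR (m n) * ((PI * INR p * e n) ^ 2 * y) = c n * (PI * INR p) ^ 2 * y).
      { intros y; unfold c, e; ring. }
      split.
      * eapply Rle_trans; [|apply cos_pow_ge; lra].
        unfold Rdiv; rewrite <- En; right; reflexivity.
      * eapply Rle_trans; [apply cos_pow_le|].
        rewrite <- En; apply exp_le_compat, Ropp_le_contravar, Rmult_le_compat_l; [apply pos_INR|].
        set (x := PI * INR p * e n) in *.
        replace (x ^ 2 * ((1 - x ^ 2 / 6) * (1 - x ^ 2 / 6))) with ((x - x ^ 3 / 6) ^ 2) by field.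
        apply pow_incr; split; [|apply sin_ge_cubic; lra].
        assert (x * (x * x) <= x * 1) by (apply Rmult_le_compat_l; nra).
        simpl; lra.
    + replace (A * (PI * INR p) ^ 2) with (A * (PI * INR p) ^ 2 / (1 - 0)) by field.
      apply is_lim_seq_exp_opp, is_lim_seq_div'; [exact Lm | | lra].
      apply is_lim_seq_minus'; [apply is_lim_seq_const | exact Lx2].
    + replace (A * (PI * INR p) ^ 2) with (A * (PI * INR p) ^ 2 * ((1 - 0 / 6) * (1 - 0 / 6))) by field.
      apply is_lim_seq_exp_opp, is_lim_seq_mult'; [exact Lm|].
      apply is_lim_seq_mult'; (apply is_lim_seq_minus'; [apply is_lim_seq_const|];
        apply is_lim_seq_div'; [exact Lx2 | apply is_lim_seq_const | lra]).
Qed.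

Lemma theta3_ge_1 (s : R) : 0 < s -> 1 <= theta3 s.
Proof.
  intros Hs; rewrite theta3_ZSeries by exact Hs.
  replace 1 with (theta3_term s 0%Z).
  - apply (symsum_le_ZSeries (theta3_term s) 0); [apply theta3_term_summable, Hs|].
    intros k; left; apply exp_pos.
  - unfold theta3_term; rewrite <- exp_0; f_equal; ring.
Qed.

(** The finite formula is multiplied by [sqrt m / l]. One side is then [sqrt m] times the central
    weight times the normalised sum, with limit [K * theta3 t]; the other tends to
    [sqrt A * theta3 (/ t)] with [A = / (PI t)]. *)
Lemma theta3_inv_aux (K t : R) :
  is_lim_seq (fun m => sqrt (INR m) * walk m 0) K -> 0 < t ->
  theta3 (/ t) = sqrt (PI * t) * K * theta3 t.
Proof.
  intros HK Ht; pose proof PI_RGT_0 as HPI.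
  set (A := / (PI * t)).
  assert (HA : 0 < A) by (apply Rinv_0_lt_compat; nra).
  assert (Hp : forall n, 0 <= A * INR (2 * n + 1) ^ 2).
  { intros n; apply Rmult_le_pos; [lra | apply pow2_ge_0]. }
  set (m := fun n => proj1_sig (nfloor_ex _ (Hp n))).
  assert (Hm : forall n, INR (m n) <= A * INR (2 * n + 1) ^ 2 < INR (m n) + 1).
  { intros n; apply (proj2_sig (nfloor_ex _ (Hp n))). }
  pose proof (walk_limit t m Ht Hm) as LT.
  pose proof (cos_limit t m Ht Hm) as LS.
  pose proof (is_lim_floor_ratio A m Hm) as Lc.
  assert (Lsq : is_lim_seq (fun n => sqrt (INR (m n) * (/ INR (2 * n + 1)) ^ 2)) (sqrt A)).
  { apply (is_lim_seq_continuous sqrt); [apply continuity_pt_sqrt; lra | exact Lc]. }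
  (* [m n] tends to infinity, being eventually at least [A / 2 * l^2 >= A / 2 * n]; this allows
     [m n] to be substituted into the limit that defines [K]. *)
  assert (Lm : filterlim m eventually eventually).
  { intros P [N HN].
    assert (Lc' := Lc); apply is_lim_seq_spec in Lc'; assert (HA2 : 0 < A / 2) by lra.
    destruct (Lc' (mkposreal _ HA2)) as [N1 H1]; cbn [pos] in H1.
    destruct (nfloor_ex (INR N / (A / 2))) as [N2 H2].
    { apply Rmult_le_pos; [apply pos_INR | left; apply Rinv_0_lt_compat, HA2]. }
    exists (max N1 (S N2)); intros n Hn; apply HN.
    specialize (H1 n ltac:(lia)); apply Rabs_def2 in H1.
    assert (HS : (S N2 <= n)%nat) by lia; apply le_INR in HS; rewrite S_INR in HS.
    destruct H2 as [_ H2].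
    assert (Q : INR N <= A / 2 * INR n).
    { apply Rmult_lt_compat_l with (r := A / 2) in H2; [|exact HA2].
      replace (A / 2 * (INR N / (A / 2))) with (INR N) in H2 by (field; lra). nra. }
    apply INR_le; eapply Rle_trans; [exact Q|].
    assert (Hl : INR n <= INR (2 * n + 1)) by (apply le_INR; lia).
    assert (Hl1 : 1 <= INR (2 * n + 1)) by (apply (le_INR 1); lia).
    set (l := INR (2 * n + 1)) in *.
    assert (A / 2 * l ^ 2 <= INR (m n)).
    { replace (INR (m n)) with (INR (m n) * (/ l) ^ 2 * l ^ 2) by (field; lra).
      apply Rmult_le_compat_r; [apply pow2_ge_0 | lra]. }
    eapply Rle_trans; [apply Rmult_le_compat_l with (r2 := l ^ 2)|]; [lra | nra | assumption]. }
  assert (LK : is_lim_seq (fun n => sqrt (INR (m n)) * walk (m n) 0) K).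
  { apply (filterlim_comp _ _ _ m (fun m => sqrt (INR m) * walk m 0) _ _ _ Lm HK). }
  assert (Hprod : is_lim_seq (fun n =>
     sqrt (INR (m n) * (/ INR (2 * n + 1)) ^ 2) *
     symsum (fun j => cos (PI * IZR j / INR (2 * n + 1)) ^ (2 * m n)) n) (K * theta3 t)).
  { apply (is_lim_seq_ext (fun n => (sqrt (INR (m n)) * walk (m n) 0) *
       ZSeries (fun k => / walk (m n) 0 * walk (m n) (k * Z.of_nat (2 * n + 1))))).
    - intros n; destruct (walk_Poisson n (m n)) as [_ W]; rewrite <- W.
      assert (Hl : 0 < INR (2 * n + 1)) by (apply lt_0_INR; lia).
      rewrite ZSeries_scal, sqrt_mult, sqrt_pow2.
      + field; split; [lra | apply Rgt_not_eq, walk_0_pos].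
      + left; apply Rinv_0_lt_compat, Hl.
      + apply pos_INR.
      + apply pow2_ge_0.
    - apply is_lim_seq_mult'; [exact LK | exact LT]. }
  pose proof (is_lim_seq_mult' _ _ _ _ Lsq LS) as Hprod'.
  apply is_lim_seq_unique in Hprod; apply is_lim_seq_unique in Hprod'.
  rewrite Hprod in Hprod'; injection Hprod' as E.
  unfold A in E; rewrite sqrt_inv in E.
  rewrite Rmult_assoc, E.
  rewrite <- Rmult_assoc, Rinv_r, Rmult_1_l; [reflexivity|].
  apply Rgt_not_eq, sqrt_lt_R0; nra.
Qed.

(* The constant is pinned down by [t = 1]. *)
Lemma theta3_inv (t : R) : 0 < t -> theta3 (/ t) = sqrt t * theta3 t.
Proof.
  intros Ht; destruct walk_0_asymptotic as [K HK]; pose proof PI_RGT_0 as HPI.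
  pose proof (theta3_inv_aux K 1 HK Rlt_0_1) as E1.
  rewrite Rinv_1, Rmult_1_r in E1.
  pose proof (theta3_ge_1 1 Rlt_0_1) as G.
  assert (E : sqrt PI * K = 1) by (apply (Rmult_eq_reg_r (theta3 1)); lra).
  rewrite (theta3_inv_aux K t HK Ht), sqrt_mult by lra.
  replace (sqrt PI * sqrt t * K) with (sqrt PI * K * sqrt t) by ring.
  rewrite E; ring.
Qed.

(** * Log-convexity of [theta3] *)

Lemma ZSeries_le (f g : Z -> R) :
  ex_series (zfold g) -> (forall k, 0 <= f k <= g k) -> ZSeries f <= ZSeries g.
Proof.
  intros Hg H; apply Series_le; [|exact Hg].
  intros n; split; [apply zfold_nonneg | apply zfold_le]; intros k; apply H.
Qed.

(** * Moments of [PI k^2] and their derivatives *)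

Definition moment_term (p : nat) (s : R) (k : Z) : R :=
  (PI * IZR k ^ 2) ^ p * exp (- (PI * IZR k ^ 2) * s).

(** Up to the sign [(-1)^p], the [p]-th derivative of [theta3] at [s]. *)
Definition moment (p : nat) (s : R) : R := ZSeries (moment_term p s).

Lemma lambda_nonneg (k : Z) : 0 <= PI * IZR k ^ 2.
Proof. pose proof PI_RGT_0; apply Rmult_le_pos; [lra | apply pow2_ge_0]. Qed.

Lemma moment_term_nonneg (p : nat) (s : R) (k : Z) : 0 <= moment_term p s k.
Proof.
  apply Rmult_le_pos; [apply pow_le, lambda_nonneg | left; apply exp_pos].
Qed.

Lemma moment_summable (p : nat) (s : R) : 0 < s -> ex_series (zfold (moment_term p s)).
Proof.
  intros Hs; pose proof PI_RGT_0 as HPI.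
  (* Half of the exponential absorbs the power: [y^p <= a^(-p) * exp (p a y)], and this [a] keeps
     [p a <= s / 2], also for [p = 0]. *)
  set (a := s / (2 * (INR p + 1))).
  pose proof (pos_INR p) as Hp.
  assert (Ha : 0 < a) by (apply Rdiv_lt_0_compat; lra).
  apply (ex_zfold_of_zexp _ (s / 2 * PI) ((/ a) ^ p)); [nra|].
  intros k; rewrite Rabs_pos_eq by apply moment_term_nonneg.
  unfold moment_term; set (y := PI * IZR k ^ 2).
  assert (Hy : 0 <= y) by apply lambda_nonneg.
  assert (H1 : y ^ p <= (/ a) ^ p * exp (INR p * (y * a))).
  { rewrite exp_nat_mul, <- Rpow_mult_distr; apply pow_incr; split; [exact Hy|].
    apply (Rmult_le_reg_l a); [exact Ha|].
    rewrite <- Rmult_assoc, Rinv_r, Rmult_1_l by lra.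
    pose proof (exp_ineq1_le (y * a)); lra. }
  eapply Rle_trans; [apply Rmult_le_compat_r; [left; apply exp_pos | exact H1]|].
  rewrite Rmult_assoc, <- exp_plus; apply Rmult_le_compat_l.
  { apply pow_le; left; apply Rinv_0_lt_compat, Ha. }
  eapply Rle_trans; [|apply gauss_le_zexp; nra].
  apply exp_le_compat.
  assert (INR p * a <= s / 2).
  { unfold a; apply (Rmult_le_reg_r (2 * (INR p + 1))); [lra|].
    replace (INR p * (s / (2 * (INR p + 1))) * (2 * (INR p + 1))) with (INR p * s) by (field; lra).
    nra. }
  replace (s / 2 * PI * IZR k ^ 2) with (s / 2 * y) by (unfold y; ring).
  nra.
Qed.

(** From [1 - u <= exp (- u)] the remainder is at most [u * (exp u - 1)], which is bounded by
    [u^2 * exp u] for [u >= 0] and by [u^2] for [u < 0]. *)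
Lemma exp_remainder (u : R) : Rabs (exp u - 1 - u) <= u ^ 2 * exp (Rabs u).
Proof.
  pose proof (exp_ineq1_le u) as H1; pose proof (exp_ineq1_le (- u)) as H2.
  rewrite Rabs_pos_eq by lra.
  assert (H3 : exp u - 1 <= u * exp u).
  { apply (Rmult_le_compat_r (exp u)) in H2; [|left; apply exp_pos].
    rewrite <- exp_plus, Rplus_opp_l, exp_0 in H2; lra. }
  destruct (Rle_dec 0 u) as [Hu|Hu].
  - rewrite Rabs_pos_eq by exact Hu; nra.
  - rewrite Rabs_left by lra.
    assert (1 <= exp (- u)) by lra.
    assert (exp u - 1 - u <= u * (exp u - 1)) by lra.
    assert (u * (exp u - 1) <= u ^ 2) by nra.
    pose proof (pow2_ge_0 u); nra.
Qed.

Lemma is_derive_of_quadratic (f : R -> R) (x l B d : R) :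
  0 < d -> (forall h, Rabs h <= d -> Rabs (f (x + h) - f x - h * l) <= B * h ^ 2) ->
  is_derive f x l.
Proof.
  intros Hd H; apply is_derive_Reals; intros eps He.
  assert (HB : 0 < Rabs B + 1) by (pose proof (Rabs_pos B); lra).
  assert (Hdel : 0 < Rmin d (eps / (Rabs B + 1))).
  { apply Rmin_pos; [exact Hd | apply Rdiv_lt_0_compat; lra]. }
  exists (mkposreal _ Hdel); cbn [pos]; intros h Hh0 Hh.
  assert (H1 : Rabs h <= d) by (eapply Rle_trans; [left; exact Hh | apply Rmin_l]).
  assert (H2 : Rabs h < eps / (Rabs B + 1)) by (eapply Rlt_le_trans; [exact Hh | apply Rmin_r]).
  specialize (H h H1).
  assert (Hp : 0 < Rabs h) by (apply Rabs_pos_lt, Hh0).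
  replace ((f (x + h) - f x) / h - l) with ((f (x + h) - f x - h * l) / h) by (field; exact Hh0).
  rewrite Rabs_div by exact Hh0.
  apply Rlt_div_l; [exact Hp|].
  eapply Rle_lt_trans; [exact H|].
  apply Rlt_div_r in H2; [|exact HB].
  rewrite <- (pow2_abs h); pose proof (Rle_abs B); nra.
Qed.

(** Termwise differentiation by a quadratic remainder bound uniform in [h]: the term with
    [y = PI k^2] leaves at most [h^2 y^(p + 2) exp (- y s + y |h|)], and [|h| <= s / 2] turns the
    sum of these into the moment of order [p + 2] at [s / 2]. *)
Lemma is_derive_moment (p : nat) (s : R) : 0 < s ->
  is_derive (moment p) s (- moment (S p) s).
Proof.
  intros Hs.
  apply (is_derive_of_quadratic _ _ _ (moment (S (S p)) (s / 2)) (s / 2)); [lra|].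
  intros h Hh; unfold moment.
  assert (Hsh : 0 < s + h) by (apply Rabs_le_between in Hh; lra).
  pose proof (moment_summable p (s + h) Hsh) as E1.
  pose proof (moment_summable p s Hs) as E2.
  pose proof (moment_summable (S p) s Hs) as E3.
  pose proof (moment_summable (S (S p)) (s / 2) ltac:(lra)) as E4.
  replace (ZSeries (moment_term p (s + h)) - ZSeries (moment_term p s)
            - h * - ZSeries (moment_term (S p) s))
    with (ZSeries (fun k => moment_term p (s + h) k + (-1 * moment_term p s k + h * moment_term (S p) s k))).
  2: { rewrite ZSeries_plus, ZSeries_plus, !ZSeries_scal; try ring;
       repeat (apply ex_zfold_plus || apply ex_zfold_scal || assumption). }
  rewrite (Rmult_comm _ (h ^ 2)), <- ZSeries_scal.
  apply ZSeries_abs_le; [apply ex_zfold_scal, E4|].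
  intros k; unfold moment_term; set (y := PI * IZR k ^ 2).
  assert (Hy : 0 <= y) by apply lambda_nonneg.
  replace (- y * (s + h)) with (- y * s + - y * h) by ring.
  rewrite exp_plus.
  replace (y ^ p * (exp (- y * s) * exp (- y * h)) +
            (-1 * (y ^ p * exp (- y * s)) + h * (y ^ S p * exp (- y * s))))
    with ((y ^ p * exp (- y * s)) * (exp (- y * h) - 1 - (- y * h))) by (simpl; ring).
  assert (Hyp : 0 <= y ^ p) by (apply pow_le, Hy).
  rewrite Rabs_mult, (Rabs_pos_eq (y ^ p * _)).
  2: { apply Rmult_le_pos; [exact Hyp | left; apply exp_pos]. }
  eapply Rle_trans.
  { apply Rmult_le_compat_l; [apply Rmult_le_pos; [exact Hyp | left; apply exp_pos]|].
    apply exp_remainder. }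
  replace (y ^ p * exp (- y * s) * ((- y * h) ^ 2 * exp (Rabs (- y * h))))
    with (h ^ 2 * (y ^ S (S p) * (exp (- y * s) * exp (Rabs (- y * h))))) by (simpl; ring).
  apply Rmult_le_compat_l; [apply pow2_ge_0|].
  apply Rmult_le_compat_l; [apply pow_le, Hy|].
  rewrite <- exp_plus; apply exp_le_compat.
  rewrite Rabs_mult, Rabs_Ropp, (Rabs_pos_eq y) by exact Hy. nra.
Qed.

Lemma theta3_moment (s : R) : 0 < s -> theta3 s = moment 0 s.
Proof.
  intros Hs; rewrite theta3_ZSeries by exact Hs; apply ZSeries_ext; intros k.
  unfold theta3_term, moment_term; rewrite pow_O, Rmult_1_l; f_equal; ring.
Qed.

Lemma moment_0_ge_1 (s : R) : 0 < s -> 1 <= moment 0 s.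
Proof. intros Hs; rewrite <- theta3_moment by exact Hs; apply theta3_ge_1, Hs. Qed.

Lemma moment_1_pos (s : R) : 0 < s -> 0 < moment 1 s.
Proof.
  intros Hs; pose proof PI_RGT_0 as HPI.
  eapply Rlt_le_trans; [|apply (symsum_le_ZSeries _ 1)].
  - rewrite symsum_S; change (symsum (moment_term 1 s) 0) with (moment_term 1 s 0).
    pose proof (moment_term_nonneg 1 s 0); pose proof (moment_term_nonneg 1 s (- Z.of_nat 1)).
    assert (0 < moment_term 1 s (Z.of_nat 1)).
    { unfold moment_term; apply Rmult_lt_0_compat; [|apply exp_pos]; simpl; lra. }
    lra.
  - apply moment_summable, Hs.
  - apply moment_term_nonneg.
Qed.

Lemma moment_2_ge (s : R) : 0 < s -> PI * moment 1 s <= moment 2 s.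
Proof.
  intros Hs; pose proof PI_RGT_0 as HPI.
  unfold moment; rewrite <- ZSeries_scal; apply ZSeries_le; [apply moment_summable, Hs|].
  intros k; split; [apply Rmult_le_pos; [lra | apply moment_term_nonneg]|].
  unfold moment_term; set (y := PI * IZR k ^ 2).
  assert (Hy : 0 <= y) by apply lambda_nonneg.
  assert (PI * y <= y * y).
  { unfold y; rewrite IZR_sqr_nat; destruct (Z.abs_nat k) as [|q].
    - simpl; lra.
    - assert (1 <= INR (S q)) by (apply (le_INR 1); lia).
      assert (1 <= INR (S q) ^ 2) by nra.
      assert (0 < PI * INR (S q) ^ 2) by nra. nra. }
  pose proof (exp_pos (- y * s)).
  replace (PI * (y ^ 1 * exp (- y * s))) with (PI * y * exp (- y * s)) by ring.
  replace (y ^ 2 * exp (- y * s)) with (y * y * exp (- y * s)) by ring.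
  apply Rmult_le_compat_r; lra.
Qed.

Lemma PI_gt_3 : 3 < PI.
Proof. pose proof PI2_3_2; lra. Qed.

(* For [s >= 1] each term is at most [PI * 4^(-|k|)], as [k^2 <= exp (k^2)] and [PI > 3]. *)
Lemma moment_1_le (s : R) : 1 <= s -> moment 1 s <= 2 * PI / 3.
Proof.
  intros Hs; pose proof PI_gt_3 as HPI.
  assert (B : forall n, 0 <= zfold (moment_term 1 s) (S n) <= (2 * PI / 4) * (/ 4) ^ n).
  { intros n; split; [apply zfold_nonneg, moment_term_nonneg|].
    assert (T : forall k, Z.abs_nat k = S n -> moment_term 1 s k <= PI / 4 * (/ 4) ^ n).
    { intros k Hk; unfold moment_term.
      rewrite IZR_sqr_nat, Hk; set (q := INR (S n)).
      assert (Hq : q <= q ^ 2) by apply nat_le_sqr.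
      replace (PI / 4 * (/ 4) ^ n) with (PI * (/ 4) ^ S n) by (simpl; field).
      rewrite pow_1, Rmult_assoc; apply Rmult_le_compat_l; [lra|].
      apply Rle_trans with (exp (q * (-2))).
      - assert (q ^ 2 <= exp (q ^ 2)) by (pose proof (exp_ineq1_le (q ^ 2)); lra).
        eapply Rle_trans; [apply Rmult_le_compat_r; [left; apply exp_pos | eassumption]|].
        rewrite <- exp_plus; apply exp_le_compat.
        assert (0 <= q) by apply pos_INR.
        assert (3 * q ^ 2 <= PI * q ^ 2) by (apply Rmult_le_compat_r; [apply pow2_ge_0 | lra]).
        assert (PI * q ^ 2 * 1 <= PI * q ^ 2 * s) by (apply Rmult_le_compat_l; lra). lra.
      - unfold q; rewrite exp_nat_mul; apply pow_incr; split; [left; apply exp_pos|].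
        replace (-2) with (- (1 + 1)) by ring.
        rewrite exp_Ropp; apply Rinv_le_contravar; [lra|].
        rewrite exp_plus; pose proof (exp_ineq1_le 1); nra. }
    unfold zfold; pose proof (T (Z.of_nat (S n)) ltac:(lia));
      pose proof (T (- Z.of_nat (S n))%Z ltac:(lia)); lra. }
  assert (G : Rabs (/ 4) < 1) by (rewrite Rabs_pos_eq; lra).
  unfold moment, ZSeries; rewrite Series_incr_1 by (apply moment_summable; lra).
  replace (zfold (moment_term 1 s) 0) with 0 by (simpl; unfold moment_term; simpl; ring).
  rewrite Rplus_0_l.
  eapply Rle_trans; [apply Series_le; [apply B|]|].
  - apply (ex_series_scal (V := R_NormedModule)), ex_series_geom, G.
  - rewrite Series_scal_l, Series_geom by exact G. right; field.
Qed.

(** * The logarithmic derivative and its monotonicity *)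

Definition log_theta3 (x : R) : R := ln (theta3 (exp x)).
(** This is [s * theta3' s / theta3 s], that is [- E X]; the derivative of [log_theta3] at [x] is
    its value at [exp x]. *)
Definition dlog_theta3 (s : R) : R := - (s * moment 1 s / moment 0 s).

Lemma is_derive_ln_comp (f : R -> R) (x l : R) :
  is_derive f x l -> 0 < f x -> is_derive (fun y => ln (f y)) x (l / f x).
Proof.
  intros Hf Hp; unfold Rdiv.
  apply (is_derive_comp (V := R_NormedModule) ln f x (/ f x) l); [|exact Hf].
  apply is_derive_Reals, derivable_pt_lim_ln, Hp.
Qed.

Lemma is_derive_log_theta3 (x : R) : is_derive log_theta3 x (dlog_theta3 (exp x)).
Proof.
  apply (is_derive_ext (fun y => ln (moment 0 (exp y)))).
  { intros y; unfold log_theta3; rewrite theta3_moment; [reflexivity | apply exp_pos]. }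
  pose proof (moment_0_ge_1 (exp x) (exp_pos x)) as H.
  replace (dlog_theta3 (exp x)) with ((exp x * - moment 1 (exp x)) / moment 0 (exp x)).
  2: { unfold dlog_theta3; field; lra. }
  apply (is_derive_ln_comp (fun y => moment 0 (exp y))); [|lra].
  apply (is_derive_comp (V := R_NormedModule) (moment 0) exp).
  - apply is_derive_moment, exp_pos.
  - apply is_derive_Reals, derivable_pt_lim_exp.
Qed.

Lemma is_derive_dlog_theta3 (s : R) : 0 < s ->
  is_derive dlog_theta3 s
    (((s * moment 2 s - moment 1 s) * moment 0 s - s * moment 1 s ^ 2) / moment 0 s ^ 2).
Proof.
  intros Hs; pose proof (moment_0_ge_1 s Hs) as H.
  pose proof (is_derive_moment 0 s Hs) as D0; pose proof (is_derive_moment 1 s Hs) as D1.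
  unfold dlog_theta3.
  auto_derive.
  - repeat split; [eexists; exact D1 | eexists; exact D0 | lra].
  - change (Derive (fun x => moment 0 x) s) with (Derive (moment 0) s).
    change (Derive (fun x => moment 1 x) s) with (Derive (moment 1) s).
    rewrite (is_derive_unique _ _ _ D0), (is_derive_unique _ _ _ D1); field; lra.
Qed.

(* With X = PI k^2 s under the weights exp (- X), this says Var X > E X. *)
Lemma dlog_theta3_deriv_pos (s : R) : 1 <= s ->
  0 < ((s * moment 2 s - moment 1 s) * moment 0 s - s * moment 1 s ^ 2) / moment 0 s ^ 2.
Proof.
  intros Hs; assert (Hs0 : 0 < s) by lra.
  pose proof (moment_0_ge_1 s Hs0) as H0; pose proof (moment_1_pos s Hs0) as H1.
  pose proof (moment_2_ge s Hs0) as H2; pose proof (moment_1_le s Hs) as H3.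
  pose proof PI_gt_3 as HPI.
  apply Rdiv_lt_0_compat; [|nra].
  set (a := moment 1 s) in *; set (b := moment 0 s) in *.
  (* As [b >= 1] and the coefficient of [b] is nonnegative, [b] may be replaced by [1]. By
     [moment_2_ge] what remains is at least [a * (s * PI - 1 - s * a)], and [a <= 2 * PI / 3] gives
     [s * (PI - a) >= PI / 3 > 1]. *)
  assert (A1 : s * PI * a - a <= s * moment 2 s - a) by nra.
  assert (A2 : 0 < s * PI - 1 - s * a) by nra.
  assert (A3 : 0 < s * PI * a - a - s * a ^ 2).
  { replace (s * PI * a - a - s * a ^ 2) with (a * (s * PI - 1 - s * a)) by ring.
    apply Rmult_lt_0_compat; assumption. }
  assert (A4 : 0 <= s * moment 2 s - a).
  { assert (0 <= s * a ^ 2) by (apply Rmult_le_pos; [lra | apply pow2_ge_0]). lra. }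
  nra.
Qed.

Lemma dlog_theta3_incr_ge_1 (u v : R) : 1 <= u < v -> dlog_theta3 u < dlog_theta3 v.
Proof.
  intros [Hu Huv].
  set (df := fun s => ((s * moment 2 s - moment 1 s) * moment 0 s - s * moment 1 s ^ 2) / moment 0 s ^ 2).
  destruct (MVT_gen dlog_theta3 u v df) as [c [Hc E]].
  - rewrite Rmin_left, Rmax_right by lra; intros x Hx; apply is_derive_dlog_theta3; lra.
  - rewrite Rmin_left, Rmax_right by lra; intros x Hx.
    apply derivable_continuous_pt; eexists; apply is_derive_Reals, is_derive_dlog_theta3; lra.
  - rewrite Rmin_left, Rmax_right in Hc by lra.
    pose proof (dlog_theta3_deriv_pos c ltac:(lra)) as P; fold (df c) in P; nra.
Qed.

Lemma log_theta3_opp (x : R) : log_theta3 (- x) = log_theta3 x + x / 2.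
Proof.
  unfold log_theta3; rewrite exp_Ropp, theta3_inv by apply exp_pos.
  pose proof (theta3_ge_1 (exp x) (exp_pos x)).
  rewrite ln_mult by (try apply sqrt_lt_R0, exp_pos; lra).
  replace (sqrt (exp x)) with (exp (x / 2)).
  - rewrite ln_exp; ring.
  - symmetry; apply sqrt_lem_1; [left; apply exp_pos | left; apply exp_pos|].
    rewrite <- exp_plus; f_equal; field.
Qed.

(** One function is differentiated in two ways, by the chain rule and through Jacobi's identity. The
    minus signs on both sides cancel in effect, so an increase on [x >= 0] becomes an increase on
    [x <= 0]. *)
Lemma dlog_theta3_opp (x : R) : dlog_theta3 (exp (- x)) = - / 2 - dlog_theta3 (exp x).
Proof.
  assert (D1 : is_derive (fun y => log_theta3 (- y)) x (-1 * dlog_theta3 (exp (- x)))).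
  { apply (is_derive_comp (V := R_NormedModule) log_theta3 Ropp).
    - apply is_derive_log_theta3.
    - apply is_derive_Reals, derivable_pt_lim_opp, derivable_pt_lim_id. }
  assert (D2 : is_derive (fun y => log_theta3 (- y)) x (dlog_theta3 (exp x) + / 2)).
  { apply (is_derive_ext (fun y => log_theta3 y + y / 2)).
    - intros y; symmetry; apply log_theta3_opp.
    - apply (is_derive_plus (V := R_NormedModule)); [apply is_derive_log_theta3|].
      auto_derive; [exact I | field]. }
  apply is_derive_unique in D1; apply is_derive_unique in D2; lra.
Qed.

Lemma dlog_theta3_incr (x y : R) : x < y -> dlog_theta3 (exp x) < dlog_theta3 (exp y).
Proof.
  assert (P : forall a b, 0 <= a < b -> dlog_theta3 (exp a) < dlog_theta3 (exp b)).
  { intros a b [Ha Hab]; apply dlog_theta3_incr_ge_1; split; [|apply exp_increasing, Hab].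
    pose proof (exp_ineq1_le a); lra. }
  assert (N : forall a b, a < b <= 0 -> dlog_theta3 (exp a) < dlog_theta3 (exp b)).
  { intros a b Hab; rewrite <- (Ropp_involutive a), <- (Ropp_involutive b).
    rewrite (dlog_theta3_opp (- a)), (dlog_theta3_opp (- b)).
    pose proof (P (- b) (- a) ltac:(lra)); lra. }
  intros Hxy; destruct (Rle_dec 0 x) as [Hx|Hx]; [apply P; lra|].
  destruct (Rle_dec y 0) as [Hy|Hy]; [apply N; lra|].
  apply Rlt_trans with (dlog_theta3 (exp 0)); [apply N | apply P]; lra.
Qed.

Lemma log_theta3_strictly_convex (x y : R) : 0 < y ->
  2 * log_theta3 x < log_theta3 (x + y) + log_theta3 (x - y).
Proof.
  intros Hy.
  assert (C : forall a b, a < b -> exists c, a <= c <= b /\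
              log_theta3 b - log_theta3 a = dlog_theta3 (exp c) * (b - a)).
  { intros a b Hab; destruct (MVT_gen log_theta3 a b (fun x => dlog_theta3 (exp x))) as [c Hc].
    - intros z _; apply is_derive_log_theta3.
    - intros z _; apply derivable_continuous_pt; eexists; apply is_derive_Reals, is_derive_log_theta3.
    - rewrite Rmin_left, Rmax_right in Hc by lra; exists c; exact Hc. }
  (* Quarter points separate the two intermediate points strictly. *)
  destruct (C (x - y) (x - y / 2) ltac:(lra)) as [c1 [B1 E1]].
  destruct (C (x - y / 2) x ltac:(lra)) as [c2 [B2 E2]].
  destruct (C x (x + y / 2) ltac:(lra)) as [c3 [B3 E3]].
  destruct (C (x + y / 2) (x + y) ltac:(lra)) as [c4 [B4 E4]].
  pose proof (dlog_theta3_incr c1 c4 ltac:(lra)) as I1.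
  assert (I2 : dlog_theta3 (exp c2) <= dlog_theta3 (exp c3)).
  { destruct (Req_dec c2 c3) as [->|]; [lra|]; left; apply dlog_theta3_incr; lra. }
  nra.
Qed.

Lemma theta3_product_gt (r s : R) : 0 < r -> 0 < s -> s <> 1 ->
  theta3 r ^ 2 < theta3 (r * s) * theta3 (r / s).
Proof.
  intros Hr Hs Hs1.
  assert (Hrs : 0 < r * s) by nra.
  assert (Hrd : 0 < r / s) by (apply Rdiv_lt_0_compat; lra).
  pose proof (theta3_ge_1 r Hr) as G1; pose proof (theta3_ge_1 _ Hrs) as G2;
    pose proof (theta3_ge_1 _ Hrd) as G3.
  assert (L : 2 * log_theta3 (ln r) < log_theta3 (ln r + ln s) + log_theta3 (ln r - ln s)).
  { destruct (Rtotal_order s 1) as [H|[H|H]]; [|contradiction|].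
    - assert (Hl : ln s < 0) by (rewrite <- ln_1; apply ln_increasing; assumption).
      pose proof (log_theta3_strictly_convex (ln r) (- ln s) ltac:(lra)) as Q.
      replace (ln r - - ln s) with (ln r + ln s) in Q by ring.
      unfold Rminus; lra.
    - apply log_theta3_strictly_convex; rewrite <- ln_1; apply ln_increasing; lra. }
  unfold log_theta3 in L.
  rewrite <- (ln_mult r s), <- (ln_div r s) in L by assumption.
  rewrite !exp_ln in L by assumption.
  rewrite <- (ln_mult (theta3 (r * s))) in L by lra.
  apply ln_lt_inv; [nra | nra |].
  replace (theta3 r ^ 2) with (theta3 r * theta3 r) by ring.
  rewrite ln_mult by lra. lra.
Qed.

(** * Reduction of [theta4] to [theta3] *)

(** The sign as a function of parity, so that it is multiplicative in [k] on all of [Z]; the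
    exponent [Z.abs_nat k] does not respect addition. *)
Definition zsign (k : Z) : R := if Z.even k then 1 else -1.

Lemma pow_abs_nat_zsign (k : Z) : (-1) ^ (Z.abs_nat k) = zsign k.
Proof.
  assert (H : forall n, (-1) ^ n = zsign (Z.of_nat n)).
  { induction n as [|n IH]; [reflexivity|].
    rewrite <- tech_pow_Rmult, IH; unfold zsign.
    rewrite Nat2Z.inj_succ, Z.even_succ, <- Z.negb_even.
    destruct (Z.even (Z.of_nat n)); simpl; ring. }
  rewrite H, Nat2Z.inj_abs_nat; unfold zsign.
  destruct (Z.abs_eq_or_opp k) as [-> | ->]; [|rewrite Z.even_opp]; reflexivity.
Qed.

Lemma zsign_add (k d : Z) : zsign (k + d) = zsign k * zsign d.
Proof.
  unfold zsign; rewrite Z.even_add; destruct (Z.even k), (Z.even d); simpl; ring.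
Qed.

Lemma zsign_opp (k : Z) : zsign (- k) = zsign k.
Proof. unfold zsign; rewrite Z.even_opp; reflexivity. Qed.

Lemma zsign_sqr (k : Z) : zsign k * zsign k = 1.
Proof. unfold zsign; destruct (Z.even k); ring. Qed.

Lemma Rabs_zsign (k : Z) : Rabs (zsign k) = 1.
Proof.
  unfold zsign; destruct (Z.even k); [apply Rabs_R1|].
  rewrite Rabs_left; lra.
Qed.

Lemma theta4_term_sign (s : R) (k : Z) : theta4_term s k = zsign k * theta3_term s k.
Proof. unfold theta4_term; rewrite pow_abs_nat_zsign; reflexivity. Qed.

Lemma theta4_term_abs (s : R) (k : Z) : Rabs (theta4_term s k) = theta3_term s k.
Proof.
  rewrite theta4_term_sign, Rabs_mult, Rabs_zsign, Rmult_1_l.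
  apply Rabs_pos_eq; left; apply exp_pos.
Qed.

Lemma theta4_term_le (s : R) (k : Z) :
  0 < s -> Rabs (theta4_term s k) <= 1 * zexp (PI * s) k.
Proof.
  intros Hs; rewrite theta4_term_abs.
  eapply Rle_trans; [apply Rle_abs | apply theta3_term_le, Hs].
Qed.

Lemma theta4_term_summable (s : R) : 0 < s -> ex_series (zfold (theta4_term s)).
Proof.
  intros Hs; pose proof PI_RGT_0.
  apply (ex_zfold_of_zexp _ (PI * s) 1); [nra|].
  intros k; apply theta4_term_le, Hs.
Qed.

Lemma theta4_ZSeries (s : R) : 0 < s -> theta4 s = ZSeries (theta4_term s).
Proof. intros Hs; apply zsum_ZSeries, theta4_term_summable, Hs. Qed.

Lemma symsum_even (f : Z -> R) (N : nat) :
  (forall k, Z.even k = false -> f k = 0) ->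
  symsum f (2 * N) = symsum (fun e => f (2 * e)%Z) N.
Proof.
  intros H; induction N as [|N IH]; [reflexivity|].
  replace (2 * S N)%nat with (S (S (2 * N))) by lia.
  rewrite !symsum_S, IH.
  assert (Ho : Z.even (Z.of_nat (S (2 * N))) = false).
  { rewrite Nat2Z.inj_succ, Z.even_succ, Nat2Z.inj_mul, Z.odd_mul; reflexivity. }
  rewrite (H (Z.of_nat (S (2 * N)))) by exact Ho.
  rewrite (H (- Z.of_nat (S (2 * N)))%Z) by (rewrite Z.even_opp; exact Ho).
  replace (Z.of_nat (S (S (2 * N)))) with (2 * Z.of_nat (S N))%Z by lia.
  replace (- (2 * Z.of_nat (S N)))%Z with (2 * - Z.of_nat (S N))%Z by lia.
  ring.
Qed.

Lemma ZSeries_even (f : Z -> R) :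
  ex_series (zfold f) -> (forall k, Z.even k = false -> f k = 0) ->
  ZSeries f = ZSeries (fun e => f (2 * e)%Z).
Proof.
  intros E H; symmetry; apply ZSeries_eq_of_is_lim.
  apply (is_lim_seq_ext (fun N => symsum f (2 * N))).
  { intros N; apply symsum_even, H. }
  apply (is_lim_seq_subseq (symsum f) (ZSeries f) (fun N => (2 * N)%nat)).
  - apply eventually_subseq; intros n; lia.
  - apply is_lim_symsum, E.
Qed.

(* Substituting [l = k + d]: the terms with [d] odd cancel under [k -> - k - d], and
   for [d = 2e] the shift [k -> k - e] turns k^2 + (k + d)^2 into 2 k^2 + 2 e^2. *)
Lemma theta3_mul_theta4 (s : R) : 0 < s -> theta3 s * theta4 s = theta4 (2 * s) ^ 2.
Proof.
  intros Hs; pose proof PI_RGT_0 as HPI.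
  assert (H2s : 0 < 2 * s) by lra.
  rewrite (theta3_ZSeries s Hs), (theta4_ZSeries s Hs), (theta4_ZSeries _ H2s).
  set (G := fun k d : Z => theta3_term s k * theta4_term s (k + d)%Z).
  (* The third pays for the cross term: [3 (x^2 + (x + y)^2) - x^2 - y^2 = 5 x^2 + 6 x y + 2 y^2],
     which is half of [(3 x + 2 y)^2 + x^2]. *)
  set (c := PI * s / 3).
  assert (Hc : 0 < c) by (unfold c; apply Rdiv_lt_0_compat; nra).
  assert (HG : forall k d, Rabs (G k d) <= 1 * zexp c k * zexp c d).
  { intros k d; unfold G; rewrite Rabs_mult, theta4_term_abs.
    rewrite Rabs_pos_eq by (left; apply exp_pos).
    apply Rle_trans with (1 * exp (- (c * IZR k ^ 2)) * exp (- (c * IZR d ^ 2))).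
    - unfold theta3_term; rewrite Rmult_1_l, <- !exp_plus; apply exp_le_compat.
      rewrite plus_IZR; set (x := IZR k); set (y := IZR d).
      assert (0 <= 5 * x ^ 2 + 6 * x * y + 2 * y ^ 2).
      { pose proof (pow2_ge_0 (3 * x + 2 * y)); pose proof (pow2_ge_0 x). lra. }
      assert (0 <= c * (5 * x ^ 2 + 6 * x * y + 2 * y ^ 2)) by (apply Rmult_le_pos; lra).
      replace (- PI * x ^ 2 * s + - PI * (x + y) ^ 2 * s)
        with (- (3 * c * (x ^ 2 + (x + y) ^ 2))) by (unfold c; field).
      lra.
    - apply Rmult_le_compat; [| left; apply exp_pos | | apply gauss_le_zexp; lra].
      + rewrite Rmult_1_l; left; apply exp_pos.
      + rewrite !Rmult_1_l; apply gauss_le_zexp; lra. }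
  assert (HG' : forall d k, Rabs (G k d) <= zexp c d * zexp c k).
  { intros d k; eapply Rle_trans; [apply HG|]; right; ring. }
  set (I := fun d => ZSeries (fun k => G k d)).
  assert (EI : ZSeries (theta3_term s) * ZSeries (theta4_term s) = ZSeries I).
  { unfold I; rewrite <- (ZSeries_Fubini G c 1 Hc ltac:(lra) HG).
    rewrite Rmult_comm, <- ZSeries_scal; apply ZSeries_ext; intros k.
    unfold G; rewrite ZSeries_scal, Rmult_comm; f_equal.
    rewrite <- (ZSeries_shift (theta4_term s) (PI * s) 1 k ltac:(nra) ltac:(lra)).
    - apply ZSeries_ext; intros d; f_equal; lia.
    - intros d; apply theta4_term_le, Hs. }
  assert (Hodd : forall d, Z.even d = false -> I d = 0).
  { intros d Hd.
    assert (E : I d = zsign d * I d).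
    { unfold I at 1; rewrite <- ZSeries_opp.
      rewrite <- (ZSeries_shift (fun k => G (- k)%Z d) c (zexp c d) d Hc).
      - unfold I; rewrite <- ZSeries_scal; apply ZSeries_ext; intros k.
        unfold G; rewrite !theta4_term_sign.
        replace (- (k + d) + d)%Z with (- k)%Z by lia.
        rewrite zsign_opp, zsign_add; unfold theta3_term.
        rewrite !opp_IZR, <- !Rsqr_pow2, <- !Rsqr_neg.
        pose proof (zsign_sqr d) as Q.
        replace (zsign k) with (zsign k * (zsign d * zsign d)) at 1 by (rewrite Q; ring).
        ring.
      - left; apply zexp_pos.
      - intros k; eapply Rle_trans; [apply HG'|]; right; unfold zexp.
        rewrite opp_IZR, Rabs_Ropp; reflexivity. }
    unfold zsign in E; rewrite Hd in E; lra. }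
  assert (Heven : forall e, I (2 * e)%Z = ZSeries (theta4_term (2 * s)) * theta4_term (2 * s) e).
  { intros e; unfold I.
    rewrite <- (ZSeries_shift (fun k => G k (2 * e)%Z) c (zexp c (2 * e)) (- e) Hc).
    - rewrite Rmult_comm, <- ZSeries_scal; apply ZSeries_ext; intros k.
      unfold G; rewrite !theta4_term_sign.
      replace (k + - e + 2 * e)%Z with (k + e)%Z by lia.
      rewrite zsign_add; unfold theta3_term; rewrite !plus_IZR, opp_IZR.
      transitivity (zsign k * zsign e *
        (exp (- PI * (IZR k + - IZR e) ^ 2 * s) * exp (- PI * (IZR k + IZR e) ^ 2 * s))); [ring|].
      transitivity (zsign k * zsign e *
        (exp (- PI * IZR k ^ 2 * (2 * s)) * exp (- PI * IZR e ^ 2 * (2 * s)))); [|ring].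
      rewrite <- !exp_plus; do 2 f_equal; ring.
    - left; apply zexp_pos.
    - intros k; apply HG'. }
  assert (HIs : ex_series (zfold I)).
  { apply (ex_zfold_of_zexp I c (ZSeries (zexp c)) Hc); intros d.
    rewrite Rmult_comm, <- ZSeries_scal; apply ZSeries_abs_le.
    - apply ex_zfold_scal, ex_zfold_zexp, Hc.
    - intros k; apply HG'. }
  rewrite EI, (ZSeries_even I HIs Hodd), (ZSeries_ext _ _ Heven), ZSeries_scal; ring.
Qed.

Lemma theta4_near_1 (a : R) : 1 <= a ->
  Rabs (theta4 a - 1) <= theta3 (1 / 2) * exp (- (PI / 2 * a)).
Proof.
  intros Ha; pose proof PI_RGT_0 as HPI.
  rewrite theta4_ZSeries, theta3_ZSeries by lra.
  set (delta := fun k : Z => if Z_le_dec (Z.abs k) (Z.of_nat 0) then 1 else 0).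
  assert (Ed : ZSeries delta = 1) by (unfold delta; rewrite symsum_trunc; reflexivity).
  assert (Hd : ex_series (zfold delta)).
  { apply (ex_zfold_of_zexp delta 1 1 Rlt_0_1); intros k; unfold delta.
    destruct (Z_le_dec _ _) as [H|H].
    - replace k with 0%Z by lia; unfold zexp; rewrite Rabs_R0, Rabs_R1, Rmult_0_r, exp_0; lra.
    - rewrite Rabs_R0, Rmult_1_l; left; apply zexp_pos. }
  replace (ZSeries (theta4_term a) - 1)
    with (ZSeries (fun k => theta4_term a k + -1 * delta k)).
  2: { rewrite ZSeries_plus, ZSeries_scal, Ed; [ring | apply theta4_term_summable; lra |].
       apply ex_zfold_scal, Hd. }
  rewrite Rmult_comm, <- ZSeries_scal; apply ZSeries_abs_le.
  { apply ex_zfold_scal, theta3_term_summable; lra. }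
  intros k; unfold delta; destruct (Z_le_dec _ _) as [H|H].
  - replace k with 0%Z by lia.
    replace (theta4_term a 0) with 1.
    + replace (1 + -1 * 1) with 0 by ring; rewrite Rabs_R0.
      left; apply Rmult_lt_0_compat; apply exp_pos.
    + unfold theta4_term; simpl; rewrite !Rmult_0_l, Rmult_0_r, Rmult_0_l, exp_0; ring.
  - rewrite Rmult_0_r, Rplus_0_r, theta4_term_abs.
    unfold theta3_term; rewrite <- exp_plus; apply exp_le_compat.
    rewrite IZR_sqr_nat; set (q := INR (Z.abs_nat k)).
    assert (Hq : 1 <= q) by (apply (le_INR 1); lia).
    assert (Hq2 : 1 <= q ^ 2) by nra.
    (* Both factors are at least [1/2]. Expanded, this reads [q^2 a >= q^2 / 2 + a / 2], which
       splits the exponential into a term of [theta3 (1 / 2)] and the decay in [a]. *)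
    assert (0 <= (q ^ 2 - 1 / 2) * (a - 1 / 2) - 1 / 4) by nra.
    assert (E : 0 <= PI * ((q ^ 2 - 1 / 2) * (a - 1 / 2) - 1 / 4)) by (apply Rmult_le_pos; lra).
    lra.
Qed.

Lemma exp_opp_le_sqr (y : R) : 0 < y -> exp (- y) <= 4 / y ^ 2.
Proof.
  intros Hy; rewrite exp_Ropp.
  replace (4 / y ^ 2) with (/ (y / 2 * (y / 2))) by (field; lra).
  apply Rinv_le_contravar; [nra|].
  replace y with (y / 2 + y / 2) at 3 by field.
  rewrite exp_plus; pose proof (exp_ineq1_le (y / 2)); nra.
Qed.

Lemma Rabs_ln_le (x : R) : Rabs (x - 1) <= 1 / 2 -> Rabs (ln x) <= 2 * Rabs (x - 1).
Proof.
  intros H; assert (B := H); apply Rabs_le_between in B.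
  assert (L : forall y, 0 < y -> ln y <= y - 1).
  { intros y Hy; pose proof (exp_ineq1_le (ln y)) as E; rewrite exp_ln in E by exact Hy; lra. }
  pose proof (L x ltac:(lra)) as L1.
  pose proof (L (/ x) ltac:(apply Rinv_0_lt_compat; lra)) as L2.
  rewrite ln_Rinv in L2 by lra.
  assert (L3 : / x - 1 <= 2 * Rabs (x - 1)).
  { apply (Rmult_le_reg_r x); [lra|].
    replace ((/ x - 1) * x) with (1 - x) by (field; lra).
    pose proof (Rabs_pos (x - 1)); pose proof (Rle_abs (- (x - 1))) as Q.
    rewrite Rabs_Ropp in Q; nra. }
  pose proof (Rle_abs (x - 1)); pose proof (Rabs_pos (x - 1)).
  apply Rabs_le; lra.
Qed.

(** Exponential decay is weakened to inverse-square decay: at [2^n a] this yields a factor [4^(-n)],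
    enough to absorb [2^n] and leave [2^(-n)]. The constant [16] is the [4] of [exp_opp_le_sqr] over
    the square of the [1/2] in [PI / 2]. *)
Lemma theta4_dyadic (a : R) : 0 < a ->
  exists C, 0 <= C /\ eventually (fun n => 2 ^ n * Rabs (theta4 (2 ^ n * a) - 1) <= C * (1 / 2) ^ n).
Proof.
  intros Ha; pose proof PI_RGT_0 as HPI.
  pose proof (theta3_ge_1 (1 / 2) ltac:(lra)) as HT.
  exists (theta3 (1 / 2) * (16 / (PI * a) ^ 2)); split.
  { apply Rmult_le_pos; [lra|]; left; apply Rdiv_lt_0_compat; [lra|]; apply pow_lt; nra. }
  assert (L : is_lim_seq (fun n => 2 ^ n) p_infty) by (apply is_lim_seq_geom_p; lra).
  apply is_lim_seq_spec in L; destruct (L (/ a)) as [N HN].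
  exists N; intros n Hn; specialize (HN n Hn).
  assert (Hp : 0 < 2 ^ n) by (apply pow_lt; lra).
  assert (H1 : 1 <= 2 ^ n * a).
  { apply (Rmult_lt_compat_r a) in HN; [|exact Ha].
    rewrite Rinv_l in HN by lra; lra. }
  eapply Rle_trans; [apply Rmult_le_compat_l; [lra | apply theta4_near_1, H1]|].
  eapply Rle_trans.
  { apply Rmult_le_compat_l; [lra|]; apply Rmult_le_compat_l; [lra|].
    apply exp_opp_le_sqr; nra. }
  replace ((1 / 2) ^ n) with (/ 2 ^ n) by (rewrite <- pow_inv; f_equal; field).
  right; field; repeat split; lra.
Qed.

Lemma half_pow_lim (C : R) : is_lim_seq (fun n => C * (1 / 2) ^ n) 0.
Proof.
  replace (Finite 0) with (Rbar_mult C 0) by (simpl; f_equal; ring).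
  apply is_lim_seq_scal_l, is_lim_seq_geom; rewrite Rabs_pos_eq; lra.
Qed.

Lemma theta4_dyadic_near_1 (a : R) : 0 < a ->
  eventually (fun n => Rabs (theta4 (2 ^ n * a) - 1) <= 1 / 2).
Proof.
  intros Ha; destruct (theta4_dyadic a Ha) as [C [HC [N HN]]].
  pose proof (half_pow_lim C) as L; apply is_lim_seq_spec in L.
  assert (H2 : 0 < 1 / 2) by lra.
  destruct (L (mkposreal _ H2)) as [N' HN']; cbn [pos] in HN'.
  exists (max N N'); intros n Hn; specialize (HN n ltac:(lia)); specialize (HN' n ltac:(lia)).
  apply Rabs_def2 in HN'.
  assert (1 <= 2 ^ n) by (apply pow_R1_Rle; lra).
  pose proof (Rabs_pos (theta4 (2 ^ n * a) - 1)); nra.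
Qed.

(** At [2^N s] the value is near [1]. Halving the argument preserves positivity, since
    [theta3 s * theta4 s] is the square of [theta4 (2 s)], already known to be nonzero, and
    [theta3 s > 0]. *)
Lemma theta4_pos (s : R) : 0 < s -> 0 < theta4 s.
Proof.
  intros Hs; destruct (theta4_dyadic_near_1 s Hs) as [N HN].
  specialize (HN N (le_n N)).
  assert (HP : 0 < theta4 (2 ^ N * s)) by (apply Rabs_le_between in HN; lra).
  clear HN; revert s Hs HP; induction N as [|N IH]; intros s Hs HP.
  - simpl in HP; rewrite Rmult_1_l in HP; exact HP.
  - assert (H2 : 0 < theta4 (2 * s)).
    { apply IH; [lra|]. replace (2 ^ N * (2 * s)) with (2 ^ S N * s) by (simpl; ring). exact HP. }
    pose proof (theta3_mul_theta4 s Hs) as E; pose proof (theta3_ge_1 s Hs).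
    apply (Rmult_lt_reg_l (theta3 s)); [lra|].
    rewrite E, Rmult_0_r; apply pow_lt, H2.
Qed.

Lemma ln_theta4_dyadic_lim (a : R) : 0 < a ->
  is_lim_seq (fun n => 2 ^ n * ln (theta4 (2 ^ n * a))) 0.
Proof.
  intros Ha; destruct (theta4_dyadic a Ha) as [C [HC [N HN]]].
  destruct (theta4_dyadic_near_1 a Ha) as [N' HN'].
  apply is_lim_seq_abs_0.
  apply (is_lim_seq_le_le_loc (fun _ => 0) _ (fun n => 2 * C * (1 / 2) ^ n)).
  - exists (max N N'); intros n Hn; specialize (HN n ltac:(lia)); specialize (HN' n ltac:(lia)).
    split; [apply Rabs_pos|].
    assert (0 < 2 ^ n) by (apply pow_lt; lra).
    rewrite Rabs_mult, (Rabs_pos_eq (2 ^ n)) by lra.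
    pose proof (Rabs_ln_le _ HN'); nra.
  - apply is_lim_seq_const.
  - apply half_pow_lim.
Qed.

Lemma ln_theta4_double (s : R) : 0 < s ->
  ln (theta4 s) = 2 * ln (theta4 (2 * s)) - ln (theta3 s).
Proof.
  intros Hs; pose proof (theta3_ge_1 s Hs); pose proof (theta4_pos s Hs);
    pose proof (theta4_pos (2 * s) ltac:(lra)).
  pose proof (theta3_mul_theta4 s Hs) as E.
  assert (E' : ln (theta3 s * theta4 s) = ln (theta4 (2 * s) * theta4 (2 * s))).
  { rewrite E; f_equal; ring. }
  rewrite !ln_mult in E' by lra; lra.
Qed.

Definition log_ratio (F : R -> R) (s r : R) : R :=
  ln (F (r * s)) + ln (F (r / s)) - 2 * ln (F r).

Lemma log_ratio_theta3_pos (r s : R) : 0 < r -> 0 < s -> s <> 1 -> 0 < log_ratio theta3 s r.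
Proof.
  intros Hr Hs Hs1; unfold log_ratio.
  pose proof (theta3_product_gt r s Hr Hs Hs1) as H.
  pose proof (theta3_ge_1 r Hr).
  pose proof (theta3_ge_1 (r * s) ltac:(nra)).
  pose proof (theta3_ge_1 (r / s) ltac:(apply Rdiv_lt_0_compat; lra)).
  apply ln_increasing in H; [|nra].
  rewrite ln_mult in H by lra.
  replace (theta3 r ^ 2) with (theta3 r * theta3 r) in H by ring.
  rewrite ln_mult in H by lra; lra.
Qed.

Lemma log_ratio_theta4_double (r s : R) : 0 < r -> 0 < s ->
  log_ratio theta4 s r = 2 * log_ratio theta4 s (2 * r) - log_ratio theta3 s r.
Proof.
  intros Hr Hs; unfold log_ratio.
  assert (0 < r / s) by (apply Rdiv_lt_0_compat; lra).
  rewrite (ln_theta4_double r), (ln_theta4_double (r * s)), (ln_theta4_double (r / s)) by nra.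
  replace (2 * r * s) with (2 * (r * s)) by ring.
  replace (2 * r / s) with (2 * (r / s)) by (unfold Rdiv; ring).
  ring.
Qed.

Lemma log_ratio_theta4_nonpos (r s : R) : 0 < r -> 0 < s -> s <> 1 -> log_ratio theta4 s r <= 0.
Proof.
  intros Hr Hs Hs1.
  assert (D : forall n, log_ratio theta4 s r <= 2 ^ n * log_ratio theta4 s (2 ^ n * r)).
  { induction n as [|n IH]; [simpl; rewrite !Rmult_1_l; lra|].
    eapply Rle_trans; [exact IH|].
    assert (Hn : 0 < 2 ^ n) by (apply pow_lt; lra).
    rewrite (log_ratio_theta4_double (2 ^ n * r)) by nra.
    pose proof (log_ratio_theta3_pos (2 ^ n * r) s ltac:(nra) Hs Hs1).
    replace (2 ^ S n * r) with (2 * (2 ^ n * r)) by (simpl; ring).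
    simpl (2 ^ S n); nra. }
  assert (Hrd : 0 < r / s) by (apply Rdiv_lt_0_compat; lra).
  assert (L : is_lim_seq (fun n => 2 ^ n * log_ratio theta4 s (2 ^ n * r)) 0).
  { apply (is_lim_seq_ext (fun n => 2 ^ n * ln (theta4 (2 ^ n * (r * s))) +
        2 ^ n * ln (theta4 (2 ^ n * (r / s))) - 2 * (2 ^ n * ln (theta4 (2 ^ n * r))))).
    - intros n; unfold log_ratio.
      replace (2 ^ n * r * s) with (2 ^ n * (r * s)) by ring.
      replace (2 ^ n * r / s) with (2 ^ n * (r / s)) by (unfold Rdiv; ring). ring.
    - replace (Finite 0) with (Finite (0 + 0 - 2 * 0)) by (f_equal; ring).
      apply is_lim_seq_minus'; [apply is_lim_seq_plus'|]; try (apply ln_theta4_dyadic_lim; nra).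
      apply is_lim_seq_mult'; [apply is_lim_seq_const | apply ln_theta4_dyadic_lim, Hr]. }
  apply (is_lim_seq_le (fun _ => log_ratio theta4 s r) _ (log_ratio theta4 s r) 0 D); [|exact L].
  apply is_lim_seq_const.
Qed.

(** Passing to the limit loses strictness. Applying the nonstrict bound at [2 * r] and doubling once
    more restores it, because [log_ratio theta3 s r > 0] is subtracted. *)
Lemma theta4_product_lt (r s : R) : 0 < r -> 0 < s -> s <> 1 ->
  theta4 (r * s) * theta4 (r / s) < theta4 r ^ 2.
Proof.
  intros Hr Hs Hs1.
  pose proof (log_ratio_theta4_double r s Hr Hs) as E.
  pose proof (log_ratio_theta4_nonpos (2 * r) s ltac:(lra) Hs Hs1).
  pose proof (log_ratio_theta3_pos r s Hr Hs Hs1).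
  pose proof (theta4_pos r Hr) as P1.
  pose proof (theta4_pos (r * s) ltac:(nra)) as P2.
  pose proof (theta4_pos (r / s) ltac:(apply Rdiv_lt_0_compat; lra)) as P3.
  apply ln_lt_inv; [nra | nra |].
  replace (theta4 r ^ 2) with (theta4 r * theta4 r) by ring.
  rewrite !ln_mult by assumption.
  unfold log_ratio in E at 1; lra.
Qed.

Theorem theorem2 :
  forall r s : R, 0 < r -> 0 < s ->
    theta3 (r * s) * theta3 (r / s) >= theta3 r ^ 2 /\
    theta4 (r * s) * theta4 (r / s) <= theta4 r ^ 2 /\
    (theta3 (r * s) * theta3 (r / s) = theta3 r ^ 2 -> s = 1) /\
    (theta4 (r * s) * theta4 (r / s) = theta4 r ^ 2 -> s = 1).
Proof.
  intros r s Hr Hs; destruct (Req_dec s 1) as [->|Hs1].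
  - rewrite Rmult_1_r, Rdiv_1_r.
    repeat split; try reflexivity; right; ring.
  - pose proof (theta3_product_gt r s Hr Hs Hs1).
    pose proof (theta4_product_lt r s Hr Hs Hs1).
    repeat split; lra.
Qed.
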